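(* Let $G$ be a finite almost simple primitive permutation group on a finite set $X$ with socle $G_0$ having a standard $t$-action, and let $k=\min\{t,n-t\}$. Suppose $n\ge 8$, $\mathrm{diam}(X,G)=2$, and that either (c) holds, or (b) holds with $G_0\ne\mathrm{PSL}_n(q)$ and $X$ not consisting of totally singular subspaces (i.e. $X\neq\mathcal{S}_t$). Then one of the following holds: (1) $(X,G)$ is as in (b) and $k=1$; (2) $(X,G)$ is as in (b), $k=2$, $G_0=\mathrm{P\Omega}^{\epsilon}_n(q)$ with $q\equiv 3\pmod 4$, and the elements of $X$ are non-degenerate $2$-spaces of type $\mathrm{O}_2^-$. Conversely, under the same standing assumptions ($n\ge 8$; (b) holds with $G_0\neq \mathrm{PSL}_n(q)$ and $X\ne \mathcal{S}_t$), if $k=1$ then $\mathrm{diam}(X,G)=2$.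
   Context: Let $G$ be a primitive permutation group on a finite set $X$. An (undirected) orbital graph of $(X,G)$ is a graph with vertex set $X$ whose edge set is a single $G$-orbit on the set of unordered $2$-element subsets of $X$. The orbital diameter $\mathrm{diam}(X,G)$ is the maximum of the diameters of all such orbital graphs. $\mathrm{Cl}_n(q)$ denotes any of the simple classical groups $\mathrm{PSL}_n(q)$, $\mathrm{PSp}_n(q)$, $\mathrm{PSU}_n(q)$, $\mathrm{P\Omega}^{\pm}_n(q)$ (or $\mathrm{P\Omega}_n(q)$, $n$ odd), with natural module $V=V_n(q)$ carrying (except for $\mathrm{PSL}$) the corresponding non-degenerate alternating, hermitian or quadratic form. An almost simple primitive group $G$ on $X$ with socle $G_0$ has a standard $t$-action if: (a) $G_0=\mathrm{A}_n$ and $X$ is the set of $t$-subsets of $\{1,\dots,n\}$; or (b) $G_0=\mathrm{Cl}_n(q)$ and $X$ is an orbit of subspaces of dimension or codimension $t$ of $V_n(q)$, arbitrary if $G_0=\mathrm{PSL}_n(q)$, and otherwise totally singular ($X=\mathcal{S}_t$), non-degenerate ($X=\mathcal{N}_t$), or, if $G_0$ is orthogonal with $q$ even, non-singular $1$-spaces ($t=1$); or (c) $G_0=\mathrm{PSL}_n(q)$, $G$ contains a graph automorphism of $G_0$, and $X$ is an orbit of unordered pairs $\{U,W\}$ of subspaces with $U\subseteq W$ or $V=U\oplus W$, $\dim U=t$, $\dim W=n-t$; or (d) $G_0=\mathrm{Sp}_n(q)$, $q$ even, point stabilizer in $G_0$ equal to $\mathrm{O}^\pm_n(q)$, $t=1$.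 For an orthogonal space, a non-degenerate $2$-space is of type $\mathrm{O}_2^+$ if it contains a non-zero singular vector, and of type $\mathrm{O}_2^-$ otherwise. *)

(* Defs.v *)
From HB Require Import structures.
From mathcomp Require Import all_boot all_order all_algebra all_fingroup all_solvable.
Set Implicit Arguments. Unset Strict Implicit. Unset Printing Implicit Defensive.
Import GRing.Theory.

Local Open Scope ring_scope.

(* G is a group of permutations of a finite type T, acting on X : {set T}.
   The orbital graph of the pair {x,y} (x <> y in X) has vertex set X and
   edges the G-orbit of the unordered pair {x,y}. *)
Definition orb_adj (T : finType) (G : {set {perm T}}) (x y u v : T) : bool :=
  [exists g in G, ((g x == u) && (g y == v)) || ((g x == v) && (g y == u))].

Fixpoint orb_within (T : finType) (G : {set {perm T}}) (x y : T) (d : nat) (u v : T) : bool :=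
  match d with
  | 0 => u == v
  | d'.+1 => orb_within G x y d' u v ||
             [exists w, orb_within G x y d' u w && orb_adj G x y w v]
  end.

Definition orb_diam_le (T : finType) (G : {set {perm T}}) (X : {set T}) (d : nat) : Prop :=
  forall x y u v, x \in X -> y \in X -> x != y -> u \in X -> v \in X ->
    orb_within G x y d u v.

Definition orb_diam_eq (T : finType) (G : {set {perm T}}) (X : {set T}) (d : nat) : Prop :=
  orb_diam_le G X d /\ ~ orb_diam_le G X d.-1.

(* A subspace is represented by its canonical generating matrix <<U>>. *)
Definition subsp (F : finFieldType) (n : nat) := {U : 'M[F]_n | (<<U>>%MS == U)}.

Definition mksub (F : finFieldType) (n : nat) (A : 'M[F]_n) : subsp F n :=
  exist (fun U : 'M[F]_n => (<<U>>%MS == U)) (<<A>>%MS) (introT eqP (genmx_id A)).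

Definition fieldaut (F : finFieldType) (s : {ffun F -> F}) : bool :=
  (s 1 == 1) && [forall x, forall y, (s (x + y) == s x + s y) && (s (x * y) == s x * s y)].

Definition idf (F : finFieldType) : {ffun F -> F} := [ffun x => x].

Definition induced (F : finFieldType) (n : nat) (s : {ffun F -> F}) (M : 'M[F]_n)
    (g : {perm subsp F n}) : bool :=
  [forall U, g U == mksub (map_mx s (val U) *m M)].

Definition PGaL (F : finFieldType) (n : nat) : {set {perm subsp F n}} :=
  [set g | [exists s : {ffun F -> F}, exists M : 'M[F]_n,
      [&& fieldaut s, M \in unitmx & induced s M g]]].

Inductive ckind := Symp | Unit | Orth.

Definition Qf (F : finFieldType) (n : nat) (Q : 'M[F]_n) (v : 'rV[F]_n) : F :=
  (v *m Q *m v^T) 0 0.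

Definition sig_of (F : finFieldType) (k : ckind) (s : {ffun F -> F}) : {ffun F -> F} :=
  if k is Unit then s else idf F.

Definition polar (F : finFieldType) (n : nat) (k : ckind) (B : 'M[F]_n) : 'M[F]_n :=
  if k is Orth then B + B^T else B.

(* (k, s, B) is a non-degenerate alternating / hermitian / quadratic form.
   For Orth, B is the matrix of the quadratic form Q(v) = v B v^T, and
   non-degeneracy means the polar form is non-degenerate (this excludes
   n odd with q even, where one uses Sp instead, as is standard). *)
Definition is_form (F : finFieldType) (n : nat) (k : ckind) (s : {ffun F -> F})
    (B : 'M[F]_n) : Prop :=
  match k with
  | Symp => B^T = - B /\ (forall i, B i i = 0) /\ B \in unitmx
  | Unit => fieldaut s /\ (forall x, s (s x) = x) /\ (exists x, s x != x) /\
            B^T = map_mx s B /\ B \in unitmx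
  | Orth => (B + B^T) \in unitmx
  end.

Definition isom (F : finFieldType) (n : nat) (k : ckind) (s : {ffun F -> F})
    (B : 'M[F]_n) (M : 'M[F]_n) : bool :=
  (M \in unitmx) &&
  (if k is Orth then [forall v : 'rV[F]_n, Qf B (v *m M) == Qf B v]
   else M *m B *m (map_mx (sig_of k s) M)^T == B).

Definition IsomImg (F : finFieldType) (n : nat) (k : ckind) (s : {ffun F -> F})
    (B : 'M[F]_n) : {set {perm subsp F n}} :=
  [set g | [exists M : 'M[F]_n, isom k s B M && induced (idf F) M g]].

(* socle: image of the derived subgroup of the isometry group, i.e.
   PSp_n(q), PSU_n(q), POmega_n^eps(q) (n >= 8) *)
Definition ClSoc (F : finFieldType) (n : nat) (k : ckind) (s : {ffun F -> F})
    (B : 'M[F]_n) : {group {perm subsp F n}} :=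
  [~: <<IsomImg k s B>>, <<IsomImg k s B>>]%G.

Definition perpB (F : finFieldType) (n : nat) (k : ckind) (s : {ffun F -> F})
    (B : 'M[F]_n) (U : 'M[F]_n) : 'M[F]_n :=
  kermx (polar k B *m (map_mx (sig_of k s) U)^T).

Definition nondeg (F : finFieldType) (n : nat) (k : ckind) (s : {ffun F -> F})
    (B : 'M[F]_n) (U : 'M[F]_n) : bool :=
  ((U :&: perpB k s B U)%MS == 0).

Definition nonsing1 (F : finFieldType) (n : nat) (B : 'M[F]_n) (U : 'M[F]_n) : bool :=
  (\rank U == 1)%N && [forall v : 'rV[F]_n, ((v <= U)%MS && (v != 0)) ==> (Qf B v != 0)].

Definition minus2 (F : finFieldType) (n : nat) (B : 'M[F]_n) (U : 'M[F]_n) : bool :=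
  [&& (\rank U == 2)%N, nondeg Orth (idf F) B U &
      [forall v : 'rV[F]_n, ((v <= U)%MS && (Qf B v == 0)) ==> (v == 0)]].

(* Case (b) with G0 <> PSL and X <> S_t: X = orbit of x0 under G, where x0 is
   a non-degenerate subspace, or (orthogonal, q even) a non-singular 1-space. *)
Definition std_b (F : finFieldType) (n : nat) (k : ckind) (s : {ffun F -> F})
    (B : 'M[F]_n) (G : {group {perm subsp F n}}) (x0 : subsp F n) : Prop :=
  let X := orbit 'P G x0 in
  let d := \rank (val x0) in
  is_form k s B /\
  ClSoc k s B \subset G /\ G \subset ('N(ClSoc k s B))%g /\ G \subset PGaL F n /\
  [primitive G, on X | 'P] /\ [faithful G, on X | 'P] /\
  (0 < d < n)%N /\
  (nondeg k s B (val x0) \/ (k = Orth /\ ~~ odd #|F| /\ nonsing1 B (val x0))).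

(* action of a semilinear map, optionally followed by the graph automorphism
   (U |-> U^perp for the standard dot product) *)
Definition act2 (F : finFieldType) (n : nat) (s : {ffun F -> F}) (M : 'M[F]_n) (b : bool)
    (U : subsp F n) : subsp F n :=
  if b then mksub (kermx (map_mx s (val U) *m M)^T) else mksub (map_mx s (val U) *m M).

Definition induced2 (F : finFieldType) (n : nat) (s : {ffun F -> F}) (M : 'M[F]_n) (b : bool)
    (g : {perm {set subsp F n}}) : bool :=
  [forall P, g P == [set act2 s M b U | U in P]].

(* image of Aut(PSL_n(q)) = PGammaL_n(q) <graph> acting on sets of subspaces *)
Definition AutL2 (F : finFieldType) (n : nat) : {set {perm {set subsp F n}}} :=
  [set g | [exists s : {ffun F -> F}, exists M : 'M[F]_n, exists b : bool,
      [&& fieldaut s, M \in unitmx & induced2 s M b g]]].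

Definition PGaL2 (F : finFieldType) (n : nat) : {set {perm {set subsp F n}}} :=
  [set g | [exists s : {ffun F -> F}, exists M : 'M[F]_n,
      [&& fieldaut s, M \in unitmx & induced2 s M false g]]].

Definition GLimg2 (F : finFieldType) (n : nat) : {set {perm {set subsp F n}}} :=
  [set g | [exists M : 'M[F]_n, (M \in unitmx) && induced2 (idf F) M false g]].

(* PSL_n(q) = image of SL_n(q) = GL_n(q)' *)
Definition PSLsoc (F : finFieldType) (n : nat) : {group {perm {set subsp F n}}} :=
  [~: <<GLimg2 F n>>, <<GLimg2 F n>>]%G.

Definition std_c (F : finFieldType) (n : nat) (G : {group {perm {set subsp F n}}})
    (t : nat) (U W : subsp F n) : Prop :=
  let X := orbit 'P G [set U; W] in
  PSLsoc F n \subset G /\ G \subset ('N(PSLsoc F n))%g /\ G \subset AutL2 F n /\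
  ~~ (G \subset PGaL2 F n) /\
  [primitive G, on X | 'P] /\ [faithful G, on X | 'P] /\
  (0 < t < n)%N /\ U != W /\
  \rank (val U) = t /\ \rank (val W) = (n - t)%N /\
  ((val U <= val W)%MS || ((val U :&: val W)%MS == 0)).

(* Main.v *)
Require Import Defs.
From HB Require Import structures.
From mathcomp Require Import all_boot all_order all_algebra all_fingroup all_solvable.
From mathcomp Require Import ring zify.

(** In case (b) the group [G] preserves orthogonality: its socle contains the
    commutators of isometries, hence all Siegel (Eichler) transformations, and a
    semilinear map normalising the socle carries a Siegel transformation to a scalar
    multiple of an isometry.  For a nondegenerate [U] with [dim U, codim U >= 2],
    say [dim U <= codim U], join [U] to its image [W] under a Siegel transformation
    chosen so that [U :&: W] has codimension 1 in [U] and [U] meets the perp of [W]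
    trivially; a member [U3] of the orbit meeting the perp of [U] in dimension at
    least 2 is then at distance at least 3 from [U].  So diameter 2 forces [k = 1],
    and possibility (2) does not occur.  Conversely, for [k = 1], Siegel
    transformations give Witt's theorem for pairs of vectors, and two points have a
    common neighbour in every orbital graph since the relevant equations are solvable
    in dimension at least 8.
    In case (c), the graph joining pairs that share a component has diameter at least
    3: two disjoint pairs admit a common neighbour only if some mixed pair of their
    components belongs to the orbit. *)

Set Implicit Arguments. Unset Strict Implicit. Unset Printing Implicit Defensive.
Import GRing.Theory.

(** Elements of [G] may twist the form by a field automorphism and rescale it, so the lower bound on
    the diameter uses only quantities that survive this: the dimensions of [U :&: W] and of
    [U :&: prp W]. The group is known only to contain the socle, so Witt's theorem for the full
    isometry group does not suffice: every move is a product of Siegel transformations, themselves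
    products of commutators. The converse compares values of [q] on points, which semilinear
    elements of [G] need not keep; primitivity repairs this, since the normal socle is transitive on
    [X] and is induced by true isometries. The bound 8 enters through isotropic vectors: the perp of
    a space [S] has one outside its radical once [dim S + dim rad S + 3 <= n], and for [S] spanned
    by two vectors the left side is at most 7. It also ensures that [U] or its perp has codimension
    at least 4. *)

(** * Sesquilinear forms and perpendicular subspaces *)

Section SesquilinearForm.
Local Open Scope ring_scope.
Variables (F : finFieldType) (n : nat) (sg : {rmorphism F -> F}).
Implicit Types (x y z u v : 'rV[F]_n) (a b c : F).

Definition sform (P : 'M[F]_n) x y : F := (x *m P *m (map_mx sg y)^T) 0 0.

Definition qform (B : 'M[F]_n) x : F := sform B x x.

Definition prp (P : 'M[F]_n) m (U : 'M[F]_(m, n)) : 'M[F]_n :=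
  kermx (P *m (map_mx sg U)^T).

Variable P : 'M[F]_n.
Local Notation beta := (sform P).

Lemma sformDl x y z : beta (x + y) z = beta x z + beta y z.
Proof. by rewrite /sform !mulmxDl mxE. Qed.

Lemma sformDr x y z : beta x (y + z) = beta x y + beta x z.
Proof. by rewrite /sform map_mxD linearD mulmxDr mxE. Qed.

Lemma sformZl a x y : beta (a *: x) y = a * beta x y.
Proof. by rewrite /sform -!scalemxAl mxE. Qed.

Lemma sformZr a x y : beta x (a *: y) = sg a * beta x y.
Proof. by rewrite /sform map_mxZ linearZ -scalemxAr mxE. Qed.

Lemma sform0l x : beta 0 x = 0.
Proof. by rewrite /sform !mul0mx mxE. Qed.

Lemma sform0r x : beta x 0 = 0.
Proof. by rewrite /sform map_mx0 trmx0 mulmx0 mxE. Qed.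

Lemma sformNl x y : beta (- x) y = - beta x y.
Proof. by rewrite -scaleN1r sformZl mulN1r. Qed.

Lemma sformNr x y : beta x (- y) = - beta x y.
Proof. by rewrite -scaleN1r sformZr rmorphN1 mulN1r. Qed.

Lemma sformBr x y z : beta x (y - z) = beta x y - beta x z.
Proof. by rewrite sformDr sformNr. Qed.

Definition sformE :=
  (sformDl, sformDr, sformZl, sformZr, sformNl, sformNr, sform0l, sform0r).

Lemma sform_mx x y : x *m P *m (map_mx sg y)^T = (beta x y)%:M.
Proof. by rewrite [LHS]mx11_scalar. Qed.

Lemma sub_prpP m (U : 'M[F]_(m, n)) x :
  reflect (forall y, (y <= U)%MS -> beta x y = 0) (x <= prp P U)%MS.
Proof.
apply: (iffP sub_kermxP) => [xU y /submxP[D ->] | xU].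
  by rewrite /sform map_mxM trmx_mul mulmxA -(mulmxA x) xU mul0mx mxE.
rewrite mulmxA; apply: trmx_inj; rewrite trmx0; apply/row_matrixP => i.
rewrite row0; apply: trmx_inj; rewrite trmx0 tr_row trmxK.
apply/matrixP => j k; rewrite !ord1 [RHS]mxE -(xU _ (row_sub i U)) /sform !mxE.
by apply: eq_bigr => l _; rewrite !mxE.
Qed.

Lemma prp_rV x y : (x <= prp P y)%MS = (beta x y == 0).
Proof.
apply/sub_prpP/eqP => [-> // | xy z /sub_rVP[a ->]].
by rewrite sformZr xy mulr0.
Qed.

Lemma prp_col_mx m1 m2 (U : 'M[F]_(m1, n)) (W : 'M[F]_(m2, n)) x :
  (x <= prp P (col_mx U W))%MS = (x <= prp P U)%MS && (x <= prp P W)%MS.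
Proof.
apply/idP/andP=> [h | [/sub_prpP hU /sub_prpP hW]].
  have /sub_prpP {}h := h.
  by split; apply/sub_prpP => y yU; apply: h; rewrite -addsmxE;
    apply: submx_trans yU _; rewrite ?addsmxSl ?addsmxSr.
apply/sub_prpP => y; rewrite -addsmxE => /sub_addsmxP[[D1 D2] /= ->].
by rewrite sformDr hU ?hW ?addr0 ?submxMl.
Qed.

Lemma prp_col2 x y z :
  (x <= prp P (col_mx y z))%MS = (beta x y == 0) && (beta x z == 0).
Proof. by rewrite prp_col_mx (prp_rV x y) (prp_rV x z). Qed.

Lemma prpS m1 m2 (U : 'M[F]_(m1, n)) (W : 'M[F]_(m2, n)) :
  (U <= W)%MS -> (prp P W <= prp P U)%MS.
Proof.
move=> sUW; apply/rV_subP => x /sub_prpP xW; apply/sub_prpP => y yU.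
by apply: xW; apply: submx_trans sUW.
Qed.

Lemma eqmx_prp m1 m2 (A : 'M[F]_(m1, n)) (C : 'M[F]_(m2, n)) :
  (A :=: C)%MS -> (prp P A :=: prp P C)%MS.
Proof. by move=> eAC; apply/eqmxP; rewrite !prpS ?eAC. Qed.

Lemma cap_prp m1 m2 (A : 'M[F]_(m1, n)) (C : 'M[F]_(m2, n)) :
  (prp P (A + C)%MS :=: prp P A :&: prp P C)%MS.
Proof.
have [_ sub] := eqmx_prp (addsmxE A C).
apply/eqmxP/andP; split; apply/rV_subP => x.
  by rewrite sub sub_capmx prp_col_mx.
by rewrite sub_capmx -(prp_col_mx A C) -sub.
Qed.

Hypothesis Punit : P \in unitmx.

Lemma rank_prp m (U : 'M[F]_(m, n)) : \rank (prp P U) = (n - \rank U)%N.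
Proof.
rewrite mxrank_ker; congr (_ - _)%N.
rewrite -(mxrank_map sg U) -(mxrank_tr (map_mx sg U)).
by rewrite -mxrank_tr trmx_mul mxrankMfree ?mxrank_tr // row_free_unit unitmx_tr.
Qed.

End SesquilinearForm.

Lemma rank_gt_ex (F : fieldType) (n m1 m2 : nat) (A : 'M[F]_(m1, n)) (B : 'M[F]_(m2, n)) :
  (\rank B < \rank A)%N -> exists2 x : 'rV[F]_n, (x <= A)%MS & ~~ (x <= B)%MS.
Proof.
move=> rBA; have /row_subPn[i iB] : ~~ (A <= B)%MS.
  by apply: contraL rBA => /mxrankS; rewrite -leqNgt.
by exists (row i A); rewrite ?row_sub.
Qed.

Lemma rank_cap_ge (F : fieldType) (n m1 m2 : nat) (A : 'M[F]_(m1, n)) (B : 'M[F]_(m2, n)) :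
  (\rank A + \rank B <= \rank (A :&: B)%MS + n)%N.
Proof. by rewrite -mxrank_sum_cap addnC leq_add2l rank_leq_col. Qed.

Lemma eqmx_mulrV (F : fieldType) (m n : nat) (A B : 'M[F]_(m, n)) :
  (forall x : 'rV[F]_m, x *m A = x *m B)%R -> A = B.
Proof. by move=> AB; apply/row_matrixP => i; rewrite !rowE AB. Qed.

(** * Isotropic vectors and Siegel transformations, uniformly in the kind of form *)

Section PolarGeometry.
Local Open Scope ring_scope.

(* A uniform treatment of the three kinds of forms: [P] is the matrix of the
   polar form [beta]; [q v = v B sg(v)^T] is the quadratic form, the hermitian
   norm [beta v v], or identically 0 in the symplectic case; [T] is the identity
   for quadratic forms and [a |-> a + eps * sg a] otherwise. *)
Record polar_geometry (F : finFieldType) (n : nat) (sg : {rmorphism F -> F})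
    (eps : F) (P B : 'M[F]_n) (T : F -> F) : Prop := PolarGeometry {
  pg_sgK : forall a, sg (sg a) = a;
  pg_eps2 : eps * eps = 1;
  pg_sg_eps : sg eps = eps;
  pg_herm : forall x y, sform sg P y x = eps * sg (sform sg P x y);
  pg_unit : P \in unitmx;
  pg_qD : forall x y,
    qform sg B (x + y) = qform sg B x + qform sg B y + T (sform sg P x y);
  pg_TD : forall a b, T (a + b) = T a + T b;
  pg_Teps : forall a, T (eps * a) = T a;
  pg_Tskew : forall a, T (a - eps * sg a) = 0;
  pg_Tnorm : forall a c, T (a * sg a * c) = a * sg a * T c;
  pg_qT : forall f c, qform sg B f = T c -> sform sg P f f = eps * c + sg c;
  pg_surj : forall x, exists c, T c = qform sg B x;
  pg_iso :
    (forall x y, sform sg P x y = 0 -> qform sg B y != 0 ->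
        exists b, qform sg B (x + b *: y) = 0) \/
    (forall x, sform sg P x x = 0 -> qform sg B x = 0) /\
    (forall x y z, sform sg P x y = 0 -> sform sg P x z = 0 -> sform sg P y z = 0 ->
        qform sg B x != 0 -> qform sg B y != 0 -> qform sg B z != 0 ->
        exists a b, let e := x + a *: y + b *: z in qform sg B e = 0)
}.

Variables (F : finFieldType) (n : nat) (sg : {rmorphism F -> F}).
Variables (eps : F) (P B : 'M[F]_n) (T : F -> F).
Hypothesis geo : polar_geometry sg eps P B T.
Implicit Types (x y z u v w s f e d : 'rV[F]_n) (a b c : F).

Local Notation beta := (sform sg P).
Local Notation q := (qform sg B).
Local Notation prp := (prp sg P).

Let sgK := pg_sgK geo.
Let eps2 := pg_eps2 geo.
Let sg_eps := pg_sg_eps geo.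
Let herm := pg_herm geo.
Let Punit := pg_unit geo.
Let qD := pg_qD geo.
Let TD := pg_TD geo.

Lemma pg_T0 : T 0 = 0.
Proof. by apply: (addrI (T 0)); rewrite -TD !addr0. Qed.

Lemma pg_TN a : T (- a) = - T a.
Proof. by apply: (addrI (T a)); rewrite -TD !subrr pg_T0. Qed.

Lemma pg_Tsg a : T (sg a) = T a.
Proof.
apply/esym/eqP; rewrite -subr_eq0 -(pg_Teps geo (sg a)) -pg_TN -TD.
by rewrite (pg_Tskew geo).
Qed.

Let T0 := pg_T0.
Let TN := pg_TN.
Let Tsg := pg_Tsg.

Lemma qZ a x : qform sg B (a *: x) = a * sg a * qform sg B x.
Proof. by rewrite /qform sformZl sformZr mulrA. Qed.

Lemma q0 : qform sg B 0 = 0.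
Proof. by rewrite /qform sform0l. Qed.

Lemma qN x : qform sg B (- x) = qform sg B x.
Proof. by rewrite /qform sformNl sformNr opprK. Qed.

Lemma qZ0 a x : qform sg B x = 0 -> qform sg B (a *: x) = 0.
Proof. by move=> x0; rewrite qZ x0 mulr0. Qed.

Lemma beta_sym0 x y : (beta x y == 0) = (beta y x == 0).
Proof.
have h u v : beta u v = 0 -> beta v u = 0 by rewrite (herm u v) => ->; rewrite rmorph0 mulr0.
by apply/eqP/eqP; apply: h.
Qed.

Lemma beta_sym x y : beta x y = 0 -> beta y x = 0.
Proof. by move/eqP; rewrite beta_sym0 => /eqP. Qed.

Lemma prpK m (U : 'M[F]_(m, n)) : (prp (prp U) :=: U)%MS.
Proof.
have sU : (U <= prp (prp U))%MS.
  apply/rV_subP => x xU; apply/sub_prpP => y /sub_prpP /(_ _ xU).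
  exact: beta_sym.
apply/eqmxP; rewrite sU andbT -(mxrank_leqif_sup sU) !rank_prp //.
by rewrite subKn // rank_leq_col.
Qed.

Lemma not_prp_ex m (U : 'M[F]_(m, n)) x :
  ~~ (x <= prp U)%MS -> exists2 d, (d <= U)%MS & beta x d != 0.
Proof.
move=> xU; have [/existsP[d /andP[]]|/existsPn h] :=
  boolP [exists d : 'rV[F]_n, (d <= U)%MS && (beta x d != 0)]; first by exists d.
case/negP: xU; apply/sub_prpP => y yU.
by move: (h y); rewrite yU negbK => /eqP.
Qed.

Lemma not_sub_ex m (U : 'M[F]_(m, n)) x :
  ~~ (x <= U)%MS -> exists2 d, (d <= prp U)%MS & beta x d != 0.
Proof. by rewrite -(prpK U) => /not_prp_ex. Qed.

(* [prp S] modulo its radical has dimension at least 3, hence contains a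
   nonzero isotropic vector; it is lifted as a vector outside of the radical. *)
Lemma isotropic_ex m (S : 'M[F]_(m, n)) :
  (\rank S + \rank (S :&: prp S)%MS + 3 <= n)%N ->
  exists e d, [/\ (e <= prp S)%MS, (d <= prp S)%MS, q e = 0 & beta d e != 0].
Proof.
move=> rS; set D := prp S.
suff [e [eD qe /not_prp_ex[d dD ed]]] :
    exists e : 'rV[F]_n, [/\ (e <= D)%MS, q e = 0 & ~~ (e <= prp D)%MS].
  by exists e, d; rewrite beta_sym0.
have {rS} rD : (\rank (D :&: prp D)%MS + 3 <= \rank D)%N.
  have -> : \rank (D :&: prp D)%MS = \rank (S :&: D)%MS.
    by rewrite capmxC; have [->] := cap_eqmx (prpK S) (eqmx_refl D).
  rewrite rank_prp //.
  by move: rS (rank_leq_col S); rewrite -/D; lia.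
have rDx (E : 'M[F]_n) x : (\rank E <= \rank (E :&: prp x)%MS + 1)%N.
  have := rank_cap_ge E (prp x); rewrite rank_prp //.
  by have := rank_leq_row x; have := rank_leq_col E; lia.
have [x xD xrad] : exists2 x : 'rV[F]_n, (x <= D)%MS & ~~ (x <= prp D)%MS.
  have [|x xD] := @rank_gt_ex _ _ _ _ D (D :&: prp D)%MS; first by lia.
  by rewrite sub_capmx xD; exists x.
have [qx|qx] := eqVneq (q x) 0; first by exists x.
(* Two orthogonal vectors suffice for alternating forms and for quadratic forms in characteristic 2.
   Otherwise three are needed, but then [beta x x = 0] forces [q x = 0], which keeps the combination
   outside the radical. *)
case: (pg_iso geo) => [alt | [aniso sq3]].
  have [|y] := @rank_gt_ex _ _ _ _ (D :&: prp x)%MS (D :&: prp D + x)%MS.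
    have [+ _] := mxrank_adds_leqif (D :&: prp D)%MS x.
    by have := rDx D x; have := rank_leq_row x; lia.
  rewrite sub_capmx prp_rV => /andP[yD yx] yrad.
  have [qy|qy] := eqVneq (q y) 0.
    exists y; split=> //; apply: contra yrad => yr.
    by apply: submx_trans (addsmxSl _ _); rewrite sub_capmx yD.
  have [b qe] := alt x y (beta_sym (eqP yx)) qy.
  exists (x + b *: y); split=> //; first by rewrite addmx_sub ?scalemx_sub.
  have [b0|b0] := eqVneq b 0; first by rewrite b0 scale0r addr0.
  apply: contra yrad => er; rewrite -[y]scale1r -(mulVf b0) -scalerA scalemx_sub //.
  rewrite -[b *: y](addKr x) addrC addmx_sub_adds ?eqmx_opp //.
  by rewrite sub_capmx er addmx_sub ?scalemx_sub.
have [|y] := @rank_gt_ex _ _ _ _ (D :&: prp x)%MS (D :&: prp D)%MS.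
  by have := rDx D x; lia.
rewrite sub_capmx prp_rV => /andP[yD yx]; rewrite sub_capmx yD andTb => yrad.
have [qy|qy] := eqVneq (q y) 0; first by exists y.
have [|z] := @rank_gt_ex _ _ _ _ (D :&: prp x :&: prp y)%MS (D :&: prp D)%MS.
  by have := rDx D x; have := rDx (D :&: prp x)%MS y; lia.
rewrite 2!sub_capmx (prp_rV _ _ _ x) (prp_rV _ _ _ y) => /andP[/andP[zD zx] zy].
rewrite sub_capmx zD andTb => zrad.
have [qz|qz] := eqVneq (q z) 0; first by exists z.
have [a [b /= qe]] :=
  sq3 x y z (beta_sym (eqP yx)) (beta_sym (eqP zx)) (beta_sym (eqP zy)) qx qy qz.
exists (x + a *: y + b *: z); split=> //.
  by rewrite !addmx_sub ?scalemx_sub.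
apply: contra qx => /sub_prpP /(_ _ xD) /eqP.
rewrite !sformE (eqP yx) (eqP zx) !mulr0 !addr0 => /eqP.
by move/aniso/eqP.
Qed.

(** [q (x + c *: e)] is [q x + T (sg c * beta x e)], and every value of [q] is a value of [T]. *)
Lemma shift_isotropic x e z : q e = 0 -> beta x e != 0 ->
  exists c, q (x + c *: e) = q z.
Proof.
move=> qe xe; have [a Ta] := pg_surj geo z; have [b Tb] := pg_surj geo x.
exists (sg ((a - b) / beta x e)).
rewrite qD qZ0 // sformZr sgK mulfVK // TD TN Ta Tb; ring.
Qed.

(** Isotropic vectors span [U]: a vector not orthogonal to [e] becomes isotropic on adding a
    multiple of [e], and a vector [x] orthogonal to [e] is [(x + d) - d]. *)
Lemma isotropic_ind m (U : 'M[F]_(m, n)) e d (p : 'rV[F]_n -> Prop) :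
  (e <= U)%MS -> (d <= U)%MS -> q e = 0 -> beta d e != 0 ->
  (forall x, (x <= U)%MS -> q x = 0 -> p x) ->
  (forall x y, (x <= U)%MS -> (y <= U)%MS -> p x -> p y -> p (x + y)) ->
  forall x, (x <= U)%MS -> p x.
Proof.
move=> eU dU qe de p0 pD.
have h x : (x <= U)%MS -> beta x e != 0 -> p x.
  move=> xU xe; have [c qc] := shift_isotropic 0 qe xe.
  have -> : x = (x + c *: e) + (- c) *: e by rewrite scaleNr addrK.
  have ? : ((x + c *: e)%R <= U)%MS by rewrite addmx_sub ?scalemx_sub.
  apply: pD; rewrite ?scalemx_sub //; apply: p0; rewrite ?scalemx_sub ?qZ0 //.
  by rewrite qc q0.
move=> x xU; have [xe|] := eqVneq (beta x e) 0; last exact: h.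
have -> : x = (x + d) + - d by rewrite addrK.
have ? : ((x + d)%R <= U)%MS by rewrite addmx_sub.
apply: pD; rewrite ?eqmx_opp //; apply: h; rewrite ?eqmx_opp //.
  by rewrite sformDl xe add0r.
by rewrite sformNl oppr_eq0.
Qed.

Lemma isotropic_not_sub m m' (U : 'M[F]_(m, n)) (W : 'M[F]_(m', n)) e d :
  (e <= U)%MS -> (d <= U)%MS -> q e = 0 -> beta d e != 0 -> ~~ (U <= W)%MS ->
  exists s, [/\ (s <= U)%MS, q s = 0 & ~~ (s <= W)%MS].
Proof.
move=> eU dU qe de UW.
have [/existsP[s /and3P[? /eqP ? ?]]|/existsPn h] :=
  boolP [exists s : 'rV[F]_n, [&& (s <= U)%MS, q s == 0 & ~~ (s <= W)%MS]].
  by exists s.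
case/negP: UW; apply/rV_subP.
apply: (isotropic_ind eU dU qe de) => [x xU qx | x y _ _]; last exact: addmx_sub.
by move: (h x); rewrite xU qx eqxx negbK.
Qed.

Definition isometry_mx (M : 'M[F]_n) : Prop :=
  [/\ M \in unitmx, forall x y, beta (x *m M) (y *m M) = beta x y
    & forall x, q (x *m M) = q x].

(** The scalar [c] takes the place of Q(f) in the Eichler transformation. As [q f = T c] fixes it
    only modulo the kernel of [T], it is a separate parameter. *)
Definition siegel s f c : 'M[F]_n :=
  1%:M + P *m (map_mx sg s)^T *m f - eps *: (P *m (map_mx sg f)^T *m s)
  - c *: (P *m (map_mx sg s)^T *m s).

Lemma siegelE x s f c :
  x *m siegel s f c =
  x + beta x s *: f - (eps * beta x f) *: s - (c * beta x s) *: s.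
Proof.
rewrite /siegel !(mulmxDr, mulmxN, mulmx1) -!scalemxAr !mulmxA !sform_mx.
by rewrite !mul_scalar_mx !scalerA.
Qed.

Definition siegel_triple s f c := [/\ q s = 0, beta s f = 0 & q f = T c].

Lemma isotropic_beta x : q x = 0 -> beta x x = 0.
Proof. by move=> qx; rewrite (pg_qT geo (c := 0)) ?T0 // rmorph0 mulr0 addr0. Qed.

Lemma siegelD s f c f' c' : q s = 0 -> beta s f = 0 -> beta s f' = 0 ->
  siegel s f c *m siegel s f' c' = siegel s (f + f') (c + c' + eps * beta f f').
Proof.
move=> qs sf sf'; apply: eqmx_mulrV => x; rewrite mulmxA !siegelE.
have ss := isotropic_beta qs; have fs := beta_sym sf; have fs' := beta_sym sf'.
rewrite !sformE ss fs sf'; apply/rowP => i; rewrite !mxE; ring.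
Qed.

Lemma siegel0 s : siegel s 0 0 = 1%:M.
Proof.
by apply: eqmx_mulrV => x; rewrite siegelE mulmx1 sform0r
  !(mulr0, mul0r, scaler0, scale0r, subr0, addr0).
Qed.

Lemma siegel_isometry s f c : siegel_triple s f c -> isometry_mx (siegel s f c).
Proof.
case=> qs sf qf; have ss := isotropic_beta qs; have fs := beta_sym sf.
split.
- suff /mulmx1_unit[] : siegel s f c *m siegel s (- f) (eps * beta f f - c) = 1%:M by [].
  rewrite siegelD ?sformNr ?sf ?oppr0 // subrr -(siegel0 s); congr siegel; ring.
- move=> x y; rewrite !siegelE !sformE ss sf fs !rmorphM /= sg_eps (pg_qT geo qf).
  rewrite (herm y s) (herm y f); ring: eps2.
- move=> x; set a := beta x s; set b := beta x f.
  have -> : x *m siegel s f c = x + (a *: f - (eps * b + c * a) *: s).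
    by rewrite siegelE -/a -/b; apply/rowP => i; rewrite !mxE; ring.
  rewrite !qD qZ -scaleNr qZ0 // qf !sformE fs -/a -/b !mulr0 T0 !addr0.
  rewrite -(pg_Tnorm geo) -addrA -TD.
  (* All correction terms are collected under one [T]; they split as [z - eps * sg z] plus a norm
     times [c - sg c], and [T] kills both. *)
  suff -> : T (a * sg a * c + (sg a * b + sg (- (eps * b + c * a)) * a)) = 0.
    by rewrite addr0.
  rewrite rmorphN rmorphD !rmorphM /= sg_eps.
  have -> : a * sg a * c + (sg a * b + - (eps * sg b + sg c * sg a) * a)
    = (sg a * b - eps * sg (sg a * b)) + (a * sg a * c - a * sg a * sg c).
    by rewrite rmorphM sgK; ring.
  by rewrite TD (pg_Tskew geo) add0r TD TN !(pg_Tnorm geo) Tsg subrr.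
Qed.

Lemma isometry_inv M : isometry_mx M -> isometry_mx (invmx M).
Proof.
case=> Mu Mb Mq; split=> [|x y|x]; first by rewrite unitmx_inv.
  by rewrite -Mb !mulmxKV.
by rewrite -Mq !mulmxKV.
Qed.

Lemma isometry_mul M N : isometry_mx M -> isometry_mx N -> isometry_mx (M *m N).
Proof.
case=> Mu Mb Mq [Nu Nb Nq]; split=> [|x y|x]; first by rewrite unitmx_mul Mu.
  by rewrite !mulmxA Nb Mb.
by rewrite mulmxA Nq Mq.
Qed.

Lemma siegel_conj M s f c : isometry_mx M ->
  invmx M *m siegel s f c *m M = siegel (s *m M) (f *m M) c.
Proof.
case=> Mu Mb _; apply: eqmx_mulrV => x.
rewrite !mulmxA !siegelE -[x in RHS](mulmxKV Mu) !Mb.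
by rewrite !(mulmxDl, mulNmx) -!scalemxAl.
Qed.

Lemma siegelDl s s' f : q s = 0 -> q s' = 0 -> q f = 0 ->
  beta s s' = 0 -> beta s f = 0 -> beta s' f = 0 ->
  siegel s f 0 *m siegel s' f 0 = siegel (s + s') f 0.
Proof.
move=> qs qs' qf ss' sf s'f; apply: eqmx_mulrV => x; rewrite mulmxA !siegelE.
have ff := isotropic_beta qf; have fs' := beta_sym s'f.
rewrite !sformE ss' fs' sf ff; apply/rowP => i; rewrite !mxE; ring.
Qed.

End PolarGeometry.

(** * Siegel transformations in the derived group, and Witt's theorem for pairs of vectors *)

Section DerivedGroup.
Local Open Scope ring_scope.
Variables (F : finFieldType) (n : nat) (sg : {rmorphism F -> F}).
Variables (eps : F) (P B : 'M[F]_n) (T : F -> F).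
Hypothesis geo : polar_geometry sg eps P B T.
Implicit Types (x y z u v w s f e d : 'rV[F]_n) (a b c : F).

Local Notation beta := (sform sg P).
Local Notation q := (qform sg B).
Local Notation prp := (prp sg P).
Local Notation siegel := (siegel sg eps P).
Local Notation isometry_mx := (isometry_mx sg P B).

Let sgK := pg_sgK geo.
Let eps2 := pg_eps2 geo.
Let herm := pg_herm geo.
Let Punit := pg_unit geo.
Let qD := pg_qD geo.
Let TD := pg_TD geo.
Let T0 := pg_T0 geo.
Let TN := pg_TN geo.
Let beta_sym := beta_sym geo.
Let beta_sym0 := beta_sym0 geo.
Let isotropic_beta := isotropic_beta geo.
Let shift_isotropic := shift_isotropic geo.
Let siegelD := siegelD geo.

Hypothesis n8 : (8 <= n)%N.

Lemma isotropic_ex2 m (S : 'M[F]_(m, n)) : (\rank S <= 2)%N ->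
  exists e d, [/\ (e <= prp S)%MS, (d <= prp S)%MS, q e = 0 & beta d e != 0].
Proof.
move=> r2; apply: (isotropic_ex geo (S := S)); have := mxrankS (capmxSl S (prp S)); lia.
Qed.

Lemma rank_col2 x y : (\rank (col_mx x y) <= 2)%N.
Proof. exact: rank_leq_row. Qed.

(* The subgroup [K] stands for the derived group of the isometry group. *)
Variable K : 'M[F]_n -> Prop.
Hypothesis K_isometry : forall M, K M -> isometry_mx M.
Hypothesis K_mul : forall M N, K M -> K N -> K (M *m N).
Hypothesis K_comm : forall M N, isometry_mx M -> isometry_mx N ->
  K (invmx M *m (invmx N *m M *m N)).

(** A commutator: [siegel s w 0] fixes [f] and sends [d'] to [d' + s], so it conjugates
    [siegel d' f 0] into [siegel (d' + s) f 0], which is [siegel d' f 0 *m siegel s f 0]. *)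
Lemma mem_K_siegel_isotropic s f : q s = 0 -> q f = 0 -> beta s f = 0 ->
  ~~ (s <= f)%MS -> f != 0 -> K (siegel s f 0).
Proof.
move=> qs qf sf s_f f0.
have [e [d [eD dD qe de]]] := isotropic_ex2 (rank_col2 s f).
have [c] := shift_isotropic 0 qe de; rewrite q0.
set d' := d + c *: e => qd.
have ee := isotropic_beta qe.
have d'e : beta d' e = beta d e by rewrite !sformE ee mulr0 addr0.
have : (d' <= prp (col_mx s f))%MS by rewrite addmx_sub ?scalemx_sub.
rewrite prp_col2 => /andP[/eqP ds /eqP df].
move: eD; rewrite prp_col2 => /andP[/eqP es /eqP ef].
(* The scalar is chosen so that [beta d' w = - eps], which makes the coefficient of [s] in [d' *m A]
   equal to 1. *)
set g := - eps / beta d e; set w := sg (g)%R *: e.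
have dw : beta d' w = - eps by rewrite sformZr sgK d'e /g mulfVK.
have qw : q w = 0 by rewrite /w qZ0.
have ws : beta w s = 0 by rewrite sformZl es mulr0.
have wf : beta w f = 0 by rewrite sformZl ef mulr0.
set A := siegel s w 0; set M := siegel d' f 0.
have Ai : isometry_mx A by apply: (siegel_isometry geo); split; rewrite ?T0 // beta_sym.
have Mi : isometry_mx M by apply: (siegel_isometry geo); split; rewrite ?T0.
suff <- : invmx M *m (invmx A *m M *m A) = siegel s f 0 by apply: K_comm.
have dA : d' *m A = d' + s.
  rewrite siegelE ds dw mulrN eps2 mul0r !scale0r scaleN1r.
  by rewrite opprK subr0 addr0.
have fA : f *m A = f.
  rewrite siegelE (beta_sym sf) (beta_sym wf).
  by rewrite !mulr0 !scale0r !subr0 addr0.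
rewrite /M (siegel_conj _ _ _ _ Ai) dA fA -(siegelDl geo) //.
by rewrite mulKmx //; case: Mi.
Qed.

Lemma isometry1 : isometry_mx 1%:M.
Proof. by split=> *; rewrite ?unitmx1 ?mulmx1. Qed.

Lemma K1 : K 1%:M.
Proof. by have := K_comm isometry1 isometry1; rewrite !invmx1 !mulmx1. Qed.

(** The composition rule [siegelD] adds [eps * beta f f'] to the scalar. For isotropic [u], [e] with
    [beta u e = eps * c], the vector [u + e] is isotropic because [T c = 0], and the transformations
    with parameters [u], [e] and [- (u + e)] multiply to [siegel s 0 c]. *)
Lemma mem_K_siegel_center s c : q s = 0 -> s != 0 -> T c = 0 -> K (siegel s 0 c).
Proof.
move=> qs s0 Tc; have [->|c0] := eqVneq c 0; first by rewrite siegel0; apply: K1.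
have [e [d []]] := isotropic_ex2 (leq_trans (rank_leq_row s) (leqnSn 1)).
rewrite (prp_rV _ _ e) (prp_rV _ _ d) => /eqP es /eqP ds qe de.
have [a] := shift_isotropic 0 qe de; rewrite q0.
set d' := d + a *: e => qd.
have ee := isotropic_beta qe.
have d'e : beta d' e = beta d e by rewrite !sformE ee mulr0 addr0.
have eps0 : eps != 0 by apply: contra_eq_neq eps2 => ->; rewrite mul0r eq_sym oner_eq0.
set u := (eps * c / beta d e) *: d'.
have ue : beta u e = eps * c by rewrite sformZl d'e mulfVK.
have qu : q u = 0 by rewrite /u qZ0.
have uu := isotropic_beta qu.
have us : beta u s = 0 by rewrite sformZl !sformE ds es mulr0 addr0 mulr0.
have ue0 : beta u e != 0 by rewrite ue mulf_neq0.
have que : q (u + e) = 0 by rewrite qD qu qe ue (pg_Teps geo) Tc !addr0.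
have kgen y z : q y = 0 -> beta y s = 0 -> beta y z != 0 -> beta s z = 0 ->
    K (siegel s y 0).
  move=> qy ys yz sz; apply: mem_K_siegel_isotropic; rewrite 1?beta_sym //.
    apply: contra s0 => /sub_rVP[t st]; move: sz; rewrite st sformZl.
    by move/eqP; rewrite mulf_eq0 (negPf yz) orbF => /eqP->; rewrite scale0r.
  by apply: contraNneq yz => ->; rewrite sform0l.
have ku : K (siegel s u 0) by apply: kgen ue0 _; rewrite // beta_sym.
have ke : K (siegel s e 0) by apply: (kgen _ u) => //; [rewrite beta_sym0 | exact: beta_sym].
have kue : K (siegel s (- (u + e)) 0).
  apply: (kgen _ e); last exact: beta_sym.
  - by rewrite qN.
  - by rewrite sformNl sformDl us es addr0 oppr0.
  - by rewrite sformNl oppr_eq0 sformDl ee addr0.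
have := K_mul (K_mul ku ke) kue.
have sue : beta s (u + e) = 0 by rewrite sformDr (beta_sym us) (beta_sym es) addr0.
rewrite (siegelD _ _ qs (beta_sym us) (beta_sym es)) (siegelD _ _ qs sue).
  by rewrite sformNr isotropic_beta // ue subrr mulrA eps2 mul1r !(oppr0, mulr0, addr0, add0r).
by rewrite sformNr sue oppr0.
Qed.

(** For fixed [s], products add the parameters [f], and isotropic vectors span the perp of [s], so
    the isotropic case yields some [c0] with [q f = T c0]; the difference [c - c0] is absorbed by
    [mem_K_siegel_center]. *)
Lemma mem_K_siegel s f c : s != 0 -> siegel_triple sg P B T s f c -> K (siegel s f c).
Proof.
move=> s0 [qs sf qf].
have [e [d [eD dD qe de]]] := isotropic_ex2 (leq_trans (rank_leq_row s) (leqnSn 1)).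
suff [c0 kc0 Tc0] : exists2 c0, K (siegel s f c0) & q f = T c0.
  have -> : siegel s f c = siegel s f c0 *m siegel s 0 (c - c0).
    rewrite siegelD ?sform0r // addr0 mulr0 addr0; congr siegel; ring.
  by apply: K_mul => //; apply: mem_K_siegel_center; rewrite // TD TN -Tc0 qf subrr.
have {sf} fD : (f <= prp s)%MS by rewrite (prp_rV _ _ f) beta_sym0 sf.
move: f fD {c qf}; apply: (isotropic_ind geo eD dD qe de) => [f | f f'].
  rewrite (prp_rV _ _ f) => /eqP fs qf.
  have [->|f0] := eqVneq f 0.
    by exists 0; rewrite ?siegel0 ?T0 ?q0 //; apply: K1.
  have [/sub_rVP[a sa]|sf] := boolP (s <= f)%MS; last first.
    by exists 0; rewrite ?T0 //; apply: mem_K_siegel_isotropic => //; apply: beta_sym.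
  (* For [f] proportional to [s], the transformation has the form [siegel s 0 c'] with [c'] in the
     kernel of [T] by skewness. *)
  have a0 : a != 0 by apply: contraNneq s0 => a0; rewrite sa a0 scale0r.
  have fa : f = a^-1 *: s by rewrite sa scalerA mulVf // scale1r.
  exists 0; rewrite ?T0 //.
  have -> : siegel s f 0 = siegel s 0 (- (a^-1 - eps * sg a^-1)).
    apply: eqmx_mulrV => x; rewrite !siegelE fa !sformE.
    by apply/rowP => i; rewrite !mxE; ring.
  by apply: mem_K_siegel_center; rewrite // TN (pg_Tskew geo) oppr0.
rewrite (prp_rV _ _ f) (prp_rV _ _ f') => /eqP fs /eqP fs' [c kc qf] [c' kc' qf'].
exists (c + c' + eps * beta f f').
  by rewrite -(siegelD _ _ qs (beta_sym fs) (beta_sym fs')); apply: K_mul.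
by rewrite !TD (pg_Teps geo) qD qf qf'.
Qed.

(** With [s] isotropic, orthogonal to [u] and [w - y] but not to [y], take [f] proportional to
    [w - y]. Such an [s] exists because the perp of the span of [u] and [w - y] is spanned by
    isotropic vectors and, as [y] is outside this span, is not contained in the perp of [y]. *)
Lemma siegel_move u y w : beta u y = beta u w -> q y = q w ->
  ~~ (y <= col_mx u (w - y)%R)%MS -> exists M, [/\ K M, u *m M = u & y *m M = w].
Proof.
move=> uyw qyw yS; set S := col_mx u (w - y)%R in yS.
have [e [d [eD dD qe de]]] := isotropic_ex2 (rank_col2 u (w - y)).
have [|s [sD qs]] := isotropic_not_sub geo (W := prp y) eD dD qe de.
  apply: contra yS => /(prpS sg P) h; rewrite -(prpK geo S).
  by apply: submx_trans h; rewrite (prpK geo y).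
rewrite (prp_rV _ _ s) beta_sym0; move: sD; rewrite prp_col2 => /andP[/eqP su /eqP sd] ys.
set a := beta y s in ys.
set f := a^-1 *: (w - y).
have sf : beta s f = 0 by rewrite sformZr sd mulr0.
have uf : beta u f = 0 by rewrite sformZr sformBr uyw subrr mulr0.
(* This value cancels the component along [s] of the image of [y]; [q f = T c] then amounts to
   [q y = q w]. *)
set c := - (eps * beta y f / a).
have st : siegel_triple sg P B T s f c.
  split=> //; have qwy : q (w - y) = - T (beta y (w - y)).
    have := qD y (w - y); rewrite addrC subrK -qyw -[LHS]addr0 -addrA => /addrI /esym/eqP.
    by rewrite addr_eq0 => /eqP.
  have -> : c = - (eps * (a^-1 * sg a^-1 * beta y (w - y))).
    by rewrite /c /f sformZr; ring.
  by rewrite qZ qwy TN (pg_Teps geo) (pg_Tnorm geo) mulrN.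
exists (siegel s f c); split.
- by apply: mem_K_siegel => //; apply: contraNneq ys => s0; rewrite /a s0 sform0r.
- by rewrite siegelE uf (beta_sym su) !mulr0 !scale0r !subr0 addr0.
- rewrite siegelE -/a scalerA divff // scale1r mulNr divfK //.
  by apply/rowP => i; rewrite !mxE; ring.
Qed.

(* One Siegel transformation suffices unless [y] lies in the span of [u] and
   [w - y]; in that case go through [y + e] for a suitable isotropic [e]. *)
Lemma witt_move u y w : beta u y = beta u w -> q y = q w ->
  ~~ (y <= u)%MS -> ~~ (w <= u)%MS -> exists M, [/\ K M, u *m M = u & y *m M = w].
Proof.
move=> uyw qyw yu wu.
have [yS|] := boolP (y <= col_mx u (w - y)%R)%MS; last exact: siegel_move.
have wS : (w <= col_mx u y)%MS.
  move: yS; rewrite -!addsmxE => /sub_addsmxP[[D1 D2] /= yE].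
  have /sub_rVP[g gE] : (D2 *m (w - y) <= (w - y)%R)%MS by apply: submxMl.
  have g0 : g != 0.
    by apply: contraNneq yu => g0; rewrite yE gE g0 scale0r addr0 submxMl.
  have -> : w = - g^-1 *: (D1 *m u) + (1 + g^-1) *: y.
    have -> : D1 *m u = y - g *: (w - y) by rewrite -gE {1}yE addrK.
    by apply/rowP => i; rewrite !mxE; field.
  by rewrite addmx_sub_adds ?scalemx_sub ?submxMl.
have [e [d [eD dD qe de]]] := isotropic_ex2 (rank_col2 u y).
have eS : ~~ (e <= col_mx u y)%MS.
  apply: contra de => eS; move/sub_prpP: dD => /(_ _ eS) ->; exact/eqP.
move: eD; rewrite prp_col2 => /andP[/eqP eu /eqP ey].
(* As [e] lies outside the span of [u] and [y], which contains [w], neither the move from [y] to [z]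
   nor that from [z] to [w] falls into the exceptional case. *)
set z := y + e.
have zy : z - y = e by rewrite /z addrC addKr.
have qz : q z = q y by rewrite qD qe (beta_sym ey) T0 !addr0.
have uz : beta u z = beta u y by rewrite sformDr (beta_sym eu) addr0.
have zS : ~~ (z <= col_mx u y)%MS.
  apply: contra eS => zS; rewrite -zy addmx_sub ?eqmx_opp // -addsmxE.
  exact: addsmxSr.
have [||M [kM uM yM]] := @siegel_move u y z _ (esym qz).
- by rewrite uz.
- rewrite zy -addsmxE; apply: contra yu => /sub_addsmxP[[D1 D2] /= yE].
  have /sub_rVP[g gE] : (D2 *m e <= e)%MS by apply: submxMl.
  have [g0|g0] := eqVneq g 0; first by rewrite yE gE g0 scale0r addr0 submxMl.
  case/negP: eS; rewrite -[e]scale1r -(mulVf g0) -scalerA -gE scalemx_sub //.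
  rewrite -[_ *m e](addKr (D1 *m u)) -yE -addsmxE addmx_sub_adds //.
  by rewrite eqmx_opp submxMl.
have [||N [kN uN zN]] := @siegel_move u z w _ (etrans qz qyw).
- by rewrite uz.
- rewrite -addsmxE; apply: contra zS => /sub_addsmxP[[D1 D2] /= zE].
  have /sub_rVP[g gE] : (D2 *m (w - z) <= (w - z)%R)%MS by apply: submxMl.
  have zE' : (1 + g) *: z = D1 *m u + g *: w.
    by rewrite scalerDl scale1r {1}zE gE scalerBr addrA subrK.
  have [g1|g1] := eqVneq (1 + g) 0.
    case/negP: wu; have gN : g = -1 by apply/eqP; rewrite -addr_eq0 addrC g1.
    move: zE'; rewrite g1 scale0r gN scaleN1r => /esym/eqP.
    by rewrite subr_eq0 => /eqP <-; rewrite submxMl.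
  rewrite -[z]scale1r -(mulVf g1) -scalerA scalemx_sub // zE' addmx_sub ?scalemx_sub //.
  by rewrite -addsmxE; apply: submx_trans (addsmxSl _ _); apply: submxMl.
exists (M *m N); split; first exact: K_mul.
  by rewrite mulmxA uM.
by rewrite mulmxA yM.
Qed.

(** The condition on [w - w0] prescribes the products of [w] with [S]. Adding a multiple of an
    isotropic [e] in the perp of [S] adjusts [q], and [beta w e != 0] keeps [w] out of [S]. *)
Lemma vector_ex m (S : 'M[F]_(m, n)) w0 z :
  (\rank S + \rank (S :&: prp S)%MS + 3 <= n)%N ->
  exists w, [/\ (w - w0 <= prp S)%MS, q w = q z & ~~ (w <= S)%MS].
Proof.
move=> /(isotropic_ex geo)[e [d [eS dS qe de]]].
have [x xS xe] : exists2 x, (x - w0 <= prp S)%MS & beta x e != 0.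
  have [w0e|] := eqVneq (beta w0 e) 0; last by exists w0; rewrite ?subrr ?sub0mx.
  by exists (w0 + d); rewrite 1?addrC ?addKr // sformDl w0e addr0.
have [c qc] := shift_isotropic z qe xe.
exists (x + c *: e); split=> //; first by rewrite addrAC addmx_sub ?scalemx_sub.
apply: contra xe => xS'; move/sub_prpP: eS => /(_ _ xS') /eqP.
by rewrite beta_sym0 !sformE isotropic_beta // mulr0 addr0.
Qed.

(* For isotropic [a] orthogonal to [y], pick an isotropic [b] orthogonal to both:
   [siegel b a 0] fixes [a] and [y] and moves some [x] to [x + a]. *)
Lemma perp_transport (th : 'rV[F]_n -> 'rV[F]_n) :
  (forall x y, th (x + y) = th x + th y) ->
  (forall M, K M -> exists l, forall x y,
     beta (th (x *m M)) (th (y *m M)) = l * beta (th x) (th y)) ->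
  forall x y, beta x y = 0 -> beta (th x) (th y) = 0.
Proof.
move=> thD thK.
have th0 : th 0 = 0 by apply: (addrI (th 0)); rewrite -thD !addr0.
have iso (a y : 'rV[F]_n) : q a = 0 -> beta a y = 0 -> beta (th a) (th y) = 0.
  move=> qa ay; have [e [d [eD dD qe de]]] := isotropic_ex2 (rank_col2 a y).
  have [|b [bD qb ba]] := isotropic_not_sub geo (W := a) eD dD qe de.
    apply/negP => /mxrankS; rewrite rank_prp //.
    by have := rank_leq_row a; have := rank_col2 a y; lia.
  have [d' d'a bd'] := not_sub_ex geo ba.
  move: bD; rewrite prp_col2 => /andP[/eqP bea /eqP by0].
  move: d'a; rewrite (prp_rV _ _ d') => /eqP d'a.
  have b0 : b != 0 by apply: contraNneq bd' => ->; rewrite sform0l.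
  have kE : K (siegel b a 0) by apply: mem_K_siegel => //; split; rewrite ?T0.
  have [l hl] := thK _ kE.
  have yE : y *m siegel b a 0 = y.
    by rewrite siegelE (beta_sym by0) (beta_sym ay) !mulr0 !scale0r !subr0 addr0.
  have aE : a *m siegel b a 0 = a.
    by rewrite siegelE (beta_sym bea) isotropic_beta // !mulr0 !scale0r !subr0 addr0.
  set x := (beta d' b)^-1 *: d'.
  have xE : x *m siegel b a 0 = x + a.
    rewrite siegelE !sformZl d'a !(mulr0, mul0r) !scale0r !subr0 mulVf ?scale1r //.
    by rewrite beta_sym0.
  (* The pair [a], [y] gives [(1 - l) * beta (th a) (th y) = 0], and the pair [x], [y] shows that
     [beta (th a) (th y)] vanishes when [l = 1]. *)
  have := hl x y; rewrite xE yE thD sformDl => hx.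
  have := hl a y; rewrite aE yE => /eqP; rewrite -subr_eq0 -{1}[beta _ _]mul1r -mulrBl.
  rewrite mulf_eq0 => /orP[l1|/eqP //].
  move: hx; rewrite -[in RHS](addr0 (beta _ _)); have -> : l = 1.
    by apply/esym/eqP; rewrite -subr_eq0.
  by rewrite mul1r => /addrI.
move=> x y xy.
have [e [d []]] := isotropic_ex2 (leq_trans (rank_leq_row y) (leqnSn 1)).
move=> eD dD qe de.
have xD : (x <= prp y)%MS by rewrite (prp_rV _ _ x) xy.
move: x xD {xy}; apply: (isotropic_ind geo eD dD qe de) => [x|x x' _ _ hx hx'].
  by rewrite (prp_rV _ _ x) => /eqP xy qx; apply: iso.
by rewrite thD sformDl hx hx' addr0.
Qed.

Lemma witt_move0 x u : q x = q u -> x != 0 -> u != 0 -> exists2 M, K M & x *m M = u.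
Proof.
move=> qxu x0 u0.
have b0 : beta 0 x = beta 0 u by rewrite !sform0l.
have x0' : ~~ (x <= (0 : 'rV[F]_n))%MS by apply: contra x0 => /submx0null ->.
have u0' : ~~ (u <= (0 : 'rV[F]_n))%MS by apply: contra u0 => /submx0null ->.
by have [M [kM _ xM]] := witt_move b0 qxu x0' u0'; exists M.
Qed.

Lemma witt_move_pair x y u w : q x = q u -> q y = q w -> beta x y = beta u w ->
  x != 0 -> u != 0 -> ~~ (y <= x)%MS -> ~~ (w <= u)%MS ->
  exists M, [/\ K M, x *m M = u & y *m M = w].
Proof.
move=> qxu qyw xy x0 u0 yx wu; have [M kM xM] := witt_move0 qxu x0 u0.
have [Mu Mb Mq] := K_isometry kM.
have qyM : q (y *m M) = q w by rewrite Mq.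
have byM : beta u (y *m M) = beta u w by rewrite -[in LHS]xM Mb.
have yMu : ~~ (y *m M <= u)%MS.
  apply: contra yx => /submxP[D yE]; apply/submxP; exists D.
  by rewrite -(mulmxK Mu y) yE -xM mulmxA mulmxK.
have [N [kN uN yN]] := witt_move byM qyM yMu wu.
exists (M *m N); split; first exact: K_mul.
  by rewrite mulmxA xM.
by rewrite mulmxA.
Qed.

Lemma hyperbolic_ex m (S : 'M[F]_(m, n)) (l : F) :
  (\rank S + \rank (S :&: prp S)%MS + 3 <= n)%N ->
  exists e d, [/\ (e <= prp S)%MS, (d <= prp S)%MS, q e = 0, q d = 0 & beta d e = l].
Proof.
case/(isotropic_ex geo) => e [d [eS dS qe de]].
have [c] := shift_isotropic 0 qe de; rewrite q0 => qd.
exists e, ((l / beta d e) *: (d + c *: e)); split=> //.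
- by rewrite scalemx_sub // addmx_sub ?scalemx_sub.
- exact: qZ0.
- by rewrite !sformE isotropic_beta // mulr0 addr0 divfK.
Qed.

(** Two planes with equal Gram matrices, one in [U] and one in its perp, are what Witt's theorem
    needs to move part of [U] into its perp. From dimension 3 on, both sides contain hyperbolic
    pairs; a 2-dimensional [U] may be anisotropic, so a basis of it is copied vector by vector. *)
Lemma gram_copy_ex m (U : 'M[F]_(m, n)) :
  \rank (U :&: prp U)%MS = 0 -> (2 <= \rank U)%N -> (\rank U + 4 <= n)%N ->
  exists a b a' b' : 'rV[F]_n,
    [/\ [/\ (a <= U)%MS, (b <= U)%MS, a != 0 & ~~ (b <= a)%MS],
        [/\ (a' <= prp U)%MS, (b' <= prp U)%MS, a' != 0 & ~~ (b' <= a')%MS]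
      & [/\ q a = q a', q b = q b' & beta a b = beta a' b']].
Proof.
move=> nd r2 r4.
have hyp_indep x y : beta x y = 1 -> q y = 0 -> y != 0 /\ ~~ (x <= y)%MS.
  move=> xy qy; have xy0 : beta x y != 0 by rewrite xy oner_eq0.
  split; first by apply: contraNneq xy0 => ->; rewrite sform0r.
  by apply: contra xy0 => /sub_rVP[t ->]; rewrite sformZl isotropic_beta // mulr0.
have [r3|r3] := leqP 3 (\rank U).
  have [|e [d [eU dU qe qd de]]] := @hyperbolic_ex _ (prp U) 1.
    rewrite rank_prp // capmxC; have [-> _] := cap_eqmx (prpK geo U) (eqmx_refl (prp U)).
    by rewrite nd; lia.
  have [|e' [d' [eU' dU' qe' qd' de']]] := @hyperbolic_ex _ U 1; first by rewrite nd; lia.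
  have [e0 ed] := hyp_indep _ _ de qe; have [e0' ed'] := hyp_indep _ _ de' qe'.
  exists e, d, e', d'; split; split; rewrite -?(prpK geo U) // ?qe ?qd //.
  by rewrite (herm d e) (herm d' e') de de'.
have [a aU a0] : exists2 a : 'rV[F]_n, (a <= U)%MS & a != 0.
  have [|a aU b] := @rank_gt_ex _ _ _ _ U (0 : 'rV[F]_n); first by rewrite mxrank0; lia.
  by exists a => //; apply: contraNneq b => ->; rewrite sub0mx.
have [|b bU ba] := @rank_gt_ex _ _ _ _ U a; first by have := rank_leq_row a; lia.
have [|a' [aU' qa' aU'']] := @vector_ex _ U 0 a; first by rewrite nd; lia.
rewrite subr0 in aU'.
have [d' dU' ad'] := not_sub_ex geo aU''.
set w0 := sg (beta a b / beta a' d') *: d'.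
have aw0 : beta a' w0 = beta a b by rewrite sformZr sgK divfK.
set S := col_mx U a'.
have radS : (S :&: prp S <= a')%MS.
  apply/rV_subP => x; rewrite sub_capmx prp_col_mx -addsmxE.
  move=> /andP[/sub_addsmxP[[D1 D2] /= xE] /andP[xU _]].
  suff -> : x = D2 *m a' by rewrite submxMl.
  have : (D1 *m U <= U :&: prp U)%MS.
    rewrite sub_capmx submxMl /= -[_ *m U](addrK (D2 *m a')) -xE.
    by rewrite addmx_sub ?eqmx_opp // mulmx_sub.
  by move/eqP: nd; rewrite mxrank_eq0 => /eqP ->; rewrite submx0 => /eqP D0; rewrite xE D0 add0r.
have [|b' [bS qb bS']] := @vector_ex _ S w0 b.
  have [rS _] := mxrank_adds_leqif U a'; rewrite addsmxE -/S in rS.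
  have r1 := mxrankS radS; have r1' := rank_leq_row a'.
  by clear -rS r1 r1' r3 n8; lia.
move: bS; rewrite prp_col_mx => /andP[bU' /=]; rewrite (prp_rV _ _ _ a') => /eqP ba'.
exists a, b, a', b'; split; split=> //.
- by rewrite -[b'](subrK w0) addmx_sub ?scalemx_sub.
- by apply: contraNneq aU'' => ->; rewrite sub0mx.
- by apply: contra bS' => b'a'; rewrite -addsmxE; apply: submx_trans (addsmxSr _ _).
- rewrite -aw0 -[b'](subrK w0) sformDr (beta_sym ba') add0r //.
Qed.

End DerivedGroup.

(** * The three kinds of forms as polar geometries *)

Section FormGeometry.
Local Open Scope ring_scope.
Variables (F : finFieldType).

Lemma fieldautP (s : {ffun F -> F}) : fieldaut s ->
  exists sg : {rmorphism F -> F}, (sg : F -> F) = s.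
Proof.
case/andP => /eqP s1 /forallP h.
have sD x y : s (x + y) = s x + s y by have /forallP/(_ y)/andP[/eqP] := h x.
have sM x y : s (x * y) = s x * s y by have /forallP/(_ y)/andP[_ /eqP] := h x.
have sB x y : s (x - y) = s x - s y.
  by apply: (addIr (s y)); rewrite subrK -sD subrK.
pose a := GRing.isZmodMorphism.Build F F s sB.
pose m := GRing.isMonoidMorphism.Build F F s (conj s1 sM).
pose sg : {rmorphism F -> F} := HB.pack (fun_of_fin s) a m.
by exists sg.
Qed.

(** An element is determined by its square and one bit telling whether it is the chosen root of that
    square; the pair [(0, false)] is not attained, which makes the inequality strict. *)
Lemma card_fixed_squares (sg : {rmorphism F -> F}) :
  (#|[set a | sg a == a]| < 2 * #|[set (a * a)%R | a in [set a | sg a == a]]|)%N.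
Proof.
set X := [set a | sg a == a]; set Sq := [set a * a | a in X].
pose r (c : F) : F := odflt 0 [pick a | a * a == c].
have rK (a : F) : r (a * a) * r (a * a) = a * a.
  by rewrite /r; case: pickP => [b /eqP //|/(_ a)]; rewrite eqxx.
have sqr_eq (a b : F) : a * a = b * b -> a = b \/ a = - b.
  move/eqP; rewrite -subr_eq0 -!expr2 subr_sqr mulf_eq0 subr_eq0 addr_eq0.
  by case/orP => /eqP; [left | right].
pose f (a : F) := (a * a, a == r (a * a)).
have f_inj : {in X &, injective f}.
  move=> a b _ _ [ab]; rewrite -ab => eqab; case: (sqr_eq _ _ ab) => // abN.
  have [ar|ar] := eqVneq a (r (a * a)).
    by move: eqab; rewrite -ar eqxx => /esym/eqP ->.
  have [ra|ra] := sqr_eq _ _ (esym (rK a)); first by case/eqP: ar.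
  have rb : b = r (a * a) by apply: oppr_inj; rewrite -abN.
  by move: eqab; rewrite -rb eqxx => /eqP.
rewrite -(card_in_imset f_inj).
have -> : (2 * #|Sq| = #|setX Sq [set: bool]|)%N by rewrite cardsX cardsT card_bool mulnC.
apply: proper_card; apply/properP; split.
  apply/subsetP => _ /imsetP[a aX ->]; rewrite in_setX /= inE andbT.
  exact: imset_f.
exists (0, false).
  by rewrite in_setX /= inE andbT; apply/imsetP; exists 0; rewrite ?inE ?rmorph0 ?mulr0.
apply/imsetP => -[a _ [/esym/eqP]]; rewrite mulf_eq0 orbb => /eqP ->.
by have /eqP := rK 0; rewrite mulr0 mulf_eq0 orbb => /eqP ->; rewrite eqxx.
Qed.

(** Pigeonhole: [x + a * a * y] and [- (b * b * z)] each run through more than half of the fixed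
    field of [sg]. *)
Lemma fixed_sum_squares (sg : {rmorphism F -> F}) (x y z : F) :
  sg x = x -> sg y = y -> sg z = z -> y != 0 -> z != 0 ->
  exists a b, [/\ sg a = a, sg b = b & x + a * a * y + b * b * z = 0].
Proof.
move=> fx fy fz y0 z0.
pose X := [set a : F | sg a == a]; pose Sq := [set a * a | a in X].
pose A := [set x + c * y | c in Sq]; pose B := [set - (c * z) | c in Sq].
have cA : #|A| = #|Sq| by apply: card_imset => a b /addrI /(mulIf y0).
have cB : #|B| = #|Sq| by apply: card_imset => a b /oppr_inj /(mulIf z0).
have sgSq c : c \in Sq -> sg c = c.
  by case/imsetP => a; rewrite inE => /eqP sa ->; rewrite rmorphM sa.
have sAB : A :|: B \subset X.
  apply/subsetP => c; rewrite inE => /orP[]/imsetP[d /sgSq sd ->].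
    by rewrite inE rmorphD rmorphM fx sd fy.
  by rewrite inE rmorphN rmorphM sd fz.
have [/pred0Pn[c /andP[/= /imsetP[d dS cd] /imsetP[d' d'S cd']]]|dAB] :=
  boolP (~~ [disjoint A & B]).
  case/imsetP: dS => a; rewrite inE => /eqP sa da.
  case/imsetP: d'S => b; rewrite inE => /eqP sb db.
  exists a, b; split => //; rewrite -da -db -cd cd'; ring.
have := card_fixed_squares sg; rewrite -/X -/Sq ltnNge => /negP[].
move: (subset_leq_card sAB); rewrite cardsU disjoint_setI0; last by rewrite negbK in dAB.
by rewrite cards0 subn0 cA cB addnn mul2n.
Qed.

Lemma matrix_sform_eq n (sg : {rmorphism F -> F}) (A B : 'M[F]_n) :
  (forall x y, sform sg A x y = sform sg B x y) -> A = B.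
Proof.
have h (C : 'M[F]_n) i j : C i j = sform sg C (delta_mx 0 i) (delta_mx 0 j).
  by rewrite /sform map_delta_mx trmx_delta -rowE -colE !mxE.
by move=> AB; apply/matrixP => i j; rewrite !h.
Qed.

Lemma sform_tr n (sg : {rmorphism F -> F}) (C : 'M[F]_n) x y :
  (forall a, sg (sg a) = a) -> sg (sform sg C x y) = sform sg (map_mx sg C)^T y x.
Proof.
move=> sgK; rewrite /sform.
have sgE (A : 'M[F]_1) : sg (A 0 0) = (map_mx sg A) 0 0 by rewrite mxE.
have sgy : map_mx sg (map_mx sg y)^T = y^T by apply/matrixP => i j; rewrite !mxE sgK.
rewrite sgE !map_mxM sgy.
suff -> : map_mx sg x *m map_mx sg C *m y^T
  = (y *m (map_mx sg C)^T *m (map_mx sg x)^T)^T by rewrite mxE.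
by rewrite !trmx_mul !trmxK mulmxA.
Qed.

Lemma sform_herm n (sg : {rmorphism F -> F}) (eps : F) (P : 'M[F]_n) :
  (forall a, sg (sg a) = a) -> P^T = eps *: map_mx sg P -> eps * eps = 1 ->
  forall x y, sform sg P y x = eps * sg (sform sg P x y).
Proof.
move=> sgK PT e2 x y; rewrite sform_tr //.
have -> : (map_mx sg P)^T = eps *: P.
  by apply: trmx_inj; rewrite trmxK linearZ /= PT scalerA e2 scale1r.
by rewrite /sform -scalemxAr -scalemxAl [in RHS]mxE mulrA e2 mul1r.
Qed.

(** A bridge is needed because [isom] asks for the preservation of the quadratic form alone or of
    [beta] alone, and [isometry_mx] for both. *)
Definition same_isometries n k (s : {ffun F -> F}) (sg : {rmorphism F -> F}) (B : 'M[F]_n) :=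
  forall M, Defs.isom k s B M <-> isometry_mx sg (polar k B) B M.

Lemma same_isometries_sesq n k (s : {ffun F -> F}) (sg : {rmorphism F -> F}) (B : 'M[F]_n) :
  k <> Orth -> (sg : F -> F) = sig_of k s ->
  (forall M, (forall x y, sform sg B (x *m M) (y *m M) = sform sg B x y) ->
     forall x, qform sg B (x *m M) = qform sg B x) ->
  same_isometries k s sg B.
Proof.
move=> kO sgE hq M; rewrite /Defs.isom; have -> : polar k B = B by case: k kO {sgE}.
have sfM x y : sform sg B (x *m M) (y *m M) = sform sg (M *m B *m (map_mx sg M)^T) x y.
  by rewrite /sform map_mxM trmx_mul !mulmxA.
split=> [/andP[Mu]|[Mu Mb _]].
  move=> hM; have {hM}/eqP hM : M *m B *m (map_mx sg M)^T == B.
    by rewrite sgE; case: k kO {sgE} hM.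
  have Mb x y : sform sg B (x *m M) (y *m M) = sform sg B x y by rewrite sfM hM.
  by split=> // x; apply: hq.
rewrite Mu /=; have : M *m B *m (map_mx sg M)^T == B.
  by apply/eqP; apply: (matrix_sform_eq (sg := sg)) => x y; rewrite -sfM Mb.
by rewrite sgE; case: k kO {sgE}.
Qed.

Lemma symp_geometry n (s : {ffun F -> F}) (B : 'M[F]_n) : is_form Symp s B ->
  exists (sg : {rmorphism F -> F}) (eps : F) (T : F -> F),
  [/\ (sg : F -> F) = sig_of Symp s, polar_geometry sg eps (polar Symp B) B T
    & same_isometries Symp s sg B].
Proof.
case=> BT [B0 Bu].
have [|sg sgE] := @fieldautP (idf F).
  by rewrite /fieldaut !ffunE eqxx /=; apply/forallP => x; apply/forallP => y; rewrite !ffunE !eqxx.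
have sgid a : sg a = a by rewrite sgE ffunE.
have mapE m p (A : 'M[F]_(m, p)) : map_mx sg A = A by apply/matrixP => i j; rewrite mxE sgid.
have N1 : (-1 : F) * -1 = 1 by rewrite mulrNN mulr1.
have herm : forall x y, sform sg B y x = -1 * sg (sform sg B x y).
  by apply: sform_herm => // [a|]; rewrite ?sgid // mapE scaleN1r.
have qDs x y : qform sg B (x + y) = qform sg B x + qform sg B y.
  by rewrite /qform !sformE (herm x y) sgid; ring.
have qs0 x : qform sg B x = 0.
  rewrite (row_sum_delta x); elim/big_ind: _ => [|u v hu hv|i _].
  - by rewrite /qform sform0l.
  - by rewrite qDs hu hv addr0.
  - rewrite qZ /qform /sform map_delta_mx trmx_delta -rowE -colE !mxE B0 mulr0 //.
(* As [sg] is the identity here, this [T] vanishes identically, as does [q]. *)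
exists sg, (-1), (fun a => a + -1 * sg a); split=> //; last first.
  by apply: same_isometries_sesq => // M _ x; rewrite !qs0.
split=> //=.
- by move=> a; rewrite !sgid.
- by move=> x y; rewrite qDs sgid; ring.
- by move=> a b; rewrite !sgid; ring.
- by move=> a; rewrite !sgid; ring.
- by move=> a; rewrite !sgid; ring.
- by move=> a c; rewrite !sgid; ring.
- by move=> f c _; rewrite [LHS](qs0 f) sgid; ring.
- by move=> x; exists 0; rewrite qs0 rmorph0 mulr0 addr0.
- by left=> x y _; rewrite qs0 eqxx.
Qed.

Lemma unit_geometry n (s : {ffun F -> F}) (B : 'M[F]_n) : is_form Unit s B ->
  exists (sg : {rmorphism F -> F}) (eps : F) (T : F -> F),
  [/\ (sg : F -> F) = sig_of Unit s, polar_geometry sg eps (polar Unit B) B T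
    & same_isometries Unit s sg B].
Proof.
case=> /fieldautP[sg sgE] [sK [[x0 x0s] [BT Bu]]]; rewrite -sgE in sK x0s BT *.
have herm : forall x y, sform sg B y x = 1 * sg (sform sg B x y).
  by apply: sform_herm; rewrite ?mulr1 ?scale1r.
have qfix x : sg (qform sg B x) = qform sg B x by rewrite [RHS]herm mul1r.
(* An element of nonzero trace: 1 unless the characteristic is 2, and then [x0], which is moved by
   [sg]. It makes the trace reach all of the fixed field, where [q] takes its values. *)
have [th th0] : exists th, th + sg th != 0.
  have [two0|] := eqVneq (1 + sg 1) 0; last by exists 1.
  exists x0; rewrite addr_eq0 eq_sym.
  suff -> : - sg x0 = sg x0 by [].
  apply/esym/eqP; rewrite -addr_eq0 -[sg x0]mul1r -mulrDl.
  by move: two0; rewrite rmorph1 => ->; rewrite mul0r.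
exists sg, 1, (fun a => a + 1 * sg a); split=> //; last first.
  by apply: same_isometries_sesq => //= M Mb x; apply: Mb.
split=> //=.
- by rewrite mulr1.
- by rewrite rmorph1.
- by move=> x y; rewrite /qform !sformE (herm x y); ring.
- by move=> a b; rewrite rmorphD; ring.
- by move=> a; rewrite !mul1r.
- by move=> a; rewrite rmorphB rmorphM rmorph1 sK; ring.
- by move=> a c; rewrite !rmorphM sK; ring.
- by move=> f c qc; rewrite [LHS]qc; ring.
- move=> x; exists (qform sg B x * th / (th + sg th)).
  by rewrite !rmorphM fmorphV rmorphD qfix sK (addrC (sg th)); field.
- right; split=> // x y z xy xz yz qx qy qz.
  have sym u v : sform sg B u v = 0 -> sform sg B v u = 0.
    by rewrite (herm u v) => ->; rewrite rmorph0 mulr0.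
  have [a [b [sa sb abE]]] := fixed_sum_squares (qfix x) (qfix y) (qfix z) qy qz.
  exists a, b; rewrite /qform !sformE xy xz yz !(sym _ _ xy, sym _ _ xz, sym _ _ yz) sa sb.
  by rewrite -[RHS]abE /qform; ring.
Qed.

Lemma orth_geometry n (s : {ffun F -> F}) (B : 'M[F]_n) : is_form Orth s B ->
  exists (sg : {rmorphism F -> F}) (eps : F) (T : F -> F),
  [/\ (sg : F -> F) = sig_of Orth s, polar_geometry sg eps (polar Orth B) B T
    & same_isometries Orth s sg B].
Proof.
move=> Bu.
have [|sg sgE] := @fieldautP (idf F).
  by rewrite /fieldaut !ffunE eqxx /=; apply/forallP => x; apply/forallP => y; rewrite !ffunE !eqxx.
have sgid a : sg a = a by rewrite sgE ffunE.
have mapE m p (A : 'M[F]_(m, p)) : map_mx sg A = A by apply/matrixP => i j; rewrite mxE sgid.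
set P := B + B^T.
have PE x y : sform sg P x y = sform sg B x y + sform sg B y x.
  rewrite -[sform sg B y x]sgid sform_tr => [|a]; last by rewrite !sgid.
  by rewrite mapE /sform mulmxDr mulmxDl mxE.
have qDs x y : qform sg B (x + y) = qform sg B x + qform sg B y + sform sg P x y.
  by rewrite PE /qform !sformE; ring.
have QfE v : Qf B v = qform sg B v by rewrite /Qf /qform /sform mapE.
exists sg, 1, id; split=> //; last first.
  move=> M; rewrite /Defs.isom; split=> [/andP[Mu /forallP Mq]|[Mu _ Mq]]; last first.
    by rewrite Mu; apply/forallP => v; rewrite !QfE Mq.
  have {}Mq x : qform sg B (x *m M) = qform sg B x by rewrite -!QfE (eqP (Mq x)).
  split=> // x y; apply: (@addrI _ (qform sg B x + qform sg B y)).
  by rewrite -[RHS]qDs -[in RHS]Mq mulmxDl qDs !Mq.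
split=> //=.
- by move=> a; rewrite !sgid.
- by rewrite mulr1.
- by move=> x y; rewrite !PE sgid; ring.
- by move=> a; rewrite mul1r.
- by move=> a; rewrite sgid; ring.
- by move=> f c qc; rewrite PE sgid -qc /qform; ring.
- by move=> x; exists (qform sg B x).
have sym u v : sform sg P u v = 0 -> sform sg P v u = 0 by rewrite !PE addrC.
(* In characteristic 2 every element is a square and two vectors suffice; in odd characteristic
   [beta x x] is [2 * q x], and three vectors are used. *)
have [two0|two0] := eqVneq (1 + 1 : F) 0; [left | right; split].
- move=> x y xy qy.
  have sq_inj : injective (fun b : F => b * b).
    move=> a b /= /eqP; rewrite -subr_eq0 -!expr2 subr_sqr mulf_eq0.
    have -> : a + b = a - b.
      by congr (a + _); apply/eqP; rewrite -addr_eq0 -[b]mul1r -mulrDl two0 mul0r.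
    by rewrite orbb subr_eq0 => /eqP.
  have : - (qform sg B x / qform sg B y) \in codom (fun b : F => b * b).
    exact: (injF_onto sq_inj).
  case/codomP => b bE; exists b.
  by rewrite qDs qZ sformZr xy sgid -bE mulNr divfK // mulr0 addr0 subrr.
- move=> x; rewrite PE => xx; apply/eqP; apply: contraTT isT => qx.
  case/eqP: two0; apply: (mulIf qx); rewrite mul0r mulrDl mul1r; exact: xx.
- move=> x y z xy xz yz qx qy qz.
  have [a [b [_ _ abE]]] :=
    fixed_sum_squares (sgid (qform sg B x)) (sgid (qform sg B y)) (sgid (qform sg B z)) qy qz.
  exists a, b; rewrite !qDs !qZ !sformE xy xz yz !sgid -[RHS]abE; ring.
Qed.

Lemma form_geometry n k (s : {ffun F -> F}) (B : 'M[F]_n) : is_form k s B ->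
  exists (sg : {rmorphism F -> F}) (eps : F) (T : F -> F),
  [/\ (sg : F -> F) = sig_of k s, polar_geometry sg eps (polar k B) B T
    & same_isometries k s sg B].
Proof.
by case: k; [apply: symp_geometry | apply: unit_geometry | apply: orth_geometry].
Qed.

End FormGeometry.

(** * Permutations of subspaces induced by linear and semilinear maps *)

HB.lock Definition pm (F : finFieldType) (n : nat) (M : 'M[F]_n) : {perm subsp F n} :=
  odflt 1%g [pick g | induced (idf F) M g].

Section SubspacePermutations.
Local Open Scope ring_scope.
Variables (F : finFieldType) (n : nat).
Implicit Types (U W : subsp F n) (M N : 'M[F]_n).

Definition spn m (A : 'M[F]_(m, n)) : subsp F n := mksub <<A>>%MS.

Lemma spn_mksub (A : 'M[F]_n) : mksub A = spn A.
Proof. by apply: val_inj; rewrite /= genmx_id. Qed.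

Lemma val_spn m (A : 'M[F]_(m, n)) : (val (spn A) :=: A)%MS.
Proof. by rewrite /= genmx_id; apply: genmxE. Qed.

Lemma spnK U : spn (val U) = U.
Proof. by apply: val_inj; rewrite /= genmx_id; apply/eqP: (valP U). Qed.

Lemma spn_eqP m1 m2 (A : 'M[F]_(m1, n)) (B : 'M[F]_(m2, n)) :
  spn A = spn B <-> (A :=: B)%MS.
Proof.
split=> [AB|AB]; last by apply: val_inj; rewrite /= !genmx_id; apply/eq_genmx.
by apply: eqmx_trans (val_spn B); rewrite -AB; apply: eqmx_sym; apply: val_spn.
Qed.

Lemma spn_eq U m (A : 'M[F]_(m, n)) : (val U :=: A)%MS -> U = spn A.
Proof. by rewrite -{2}(spnK U) => /spn_eqP. Qed.

Lemma map_idf m (A : 'M[F]_(m, n)) : map_mx (idf F) A = A.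
Proof. by apply/matrixP => i j; rewrite mxE ffunE. Qed.

Lemma induced_idfP M (g : {perm subsp F n}) :
  reflect (forall U, g U = spn (val U *m M)) (induced (idf F) M g).
Proof.
apply: (iffP forallP) => h U; last by rewrite map_idf spn_mksub -h.
by rewrite (eqP (h U)) map_idf spn_mksub.
Qed.

(** For invertible [M] the map on subspaces is injective, hence some permutation is induced and the
    default value in [pm] is not met. *)
Lemma pmE M U : M \in unitmx -> pm M U = spn (val U *m M).
Proof.
move=> Mu; suff /induced_idfP -> : induced (idf F) M (pm M) by [].
rewrite pm.unlock; case: pickP => //= noM.
have f_inj : injective (fun U => spn (val U *m M)).
  move=> U1 U2 /spn_eqP eU; rewrite -(spnK U1) -(spnK U2); apply/spn_eqP.
  have := eqmxMr (invmx M) eU; rewrite !mulmxK //.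
by have /negP[] := noM (perm f_inj); apply/induced_idfP => W; rewrite permE.
Qed.

Lemma pm_spn M m (A : 'M[F]_(m, n)) : M \in unitmx -> pm M (spn A) = spn (A *m M).
Proof. by move=> Mu; rewrite pmE //; apply/spn_eqP/eqmxMr/val_spn. Qed.

Lemma induced_pm M (g : {perm subsp F n}) :
  M \in unitmx -> induced (idf F) M g -> g = pm M.
Proof. by move=> Mu /induced_idfP gM; apply/permP => U; rewrite gM (pmE _ Mu). Qed.

Lemma pm_induced M : M \in unitmx -> induced (idf F) M (pm M).
Proof. by move=> Mu; apply/induced_idfP => U; rewrite (pmE _ Mu). Qed.

Lemma pmM M N : M \in unitmx -> N \in unitmx -> pm (M *m N) = (pm M * pm N)%g.
Proof.
move=> Mu Nu; have MNu : M *m N \in unitmx by rewrite unitmx_mul Mu.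
by apply/permP => U; rewrite permM (pmE _ Mu) (pm_spn _ Nu) (pmE _ MNu) mulmxA.
Qed.

Lemma pm1 : pm (1%:M : 'M[F]_n) = 1%g.
Proof. by apply/permP => U; rewrite perm1 (pmE _ (unitmx1 F n)) mulmx1 spnK. Qed.

Lemma pmV M : M \in unitmx -> pm (invmx M) = (pm M)^-1%g.
Proof.
move=> Mu; have Nu : invmx M \in unitmx by rewrite unitmx_inv.
by apply/esym/eqP; rewrite eq_invg_mul -(pmM Mu Nu) mulmxV // pm1.
Qed.

Lemma line_stable_scalar (A : 'M[F]_n) :
  (forall y : 'rV[F]_n, exists a, y *m A = a *: y) ->
  exists a, forall y : 'rV[F]_n, y *m A = a *: y.
Proof.
move=> hA; have [/existsP[y0 y00]|/existsPn all0] :=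
  boolP [exists y : 'rV[F]_n, y != 0]; last first.
  by exists 0 => y; move: (all0 y); rewrite negbK => /eqP ->; rewrite mul0mx scaler0.
have [a0 h0] := hA y0; exists a0 => y.
have [b hb] := hA y; have [c] := hA (y + y0).
rewrite mulmxDl hb h0 scalerDr => e.
have {}e : (b - c) *: y = (c - a0) *: y0.
  by rewrite !scalerBl; apply/eqP; rewrite subr_eq addrAC eq_sym subr_eq addrC -e addrC.
have [bc|bc] := eqVneq (b - c) 0.
  move: e; rewrite bc scale0r => /esym/eqP; rewrite scaler_eq0 (negPf y00) orbF.
  by move=> ca; rewrite -[b](subrK c) bc add0r -[c](subrK a0) (eqP ca) add0r.
rewrite -hb; have -> : y = ((b - c)^-1 * (c - a0)) *: y0.
  by rewrite -scalerA -e scalerA mulVf ?scale1r.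
by rewrite -scalemxAl h0 !scalerA mulrC.
Qed.

Section Semilinear.
Variables (tau : {rmorphism F -> F}) (M : 'M[F]_n).
Hypothesis Mu : M \in unitmx.

Definition slin m (A : 'M[F]_(m, n)) : 'M[F]_(m, n) := map_mx tau A *m M.

Lemma rank_slin m (A : 'M[F]_(m, n)) : \rank (slin A) = \rank A.
Proof. by rewrite mxrankMfree ?row_free_unit // mxrank_map. Qed.

Lemma slinS m1 m2 (A : 'M[F]_(m1, n)) (B : 'M[F]_(m2, n)) :
  (A <= B)%MS -> (slin A <= slin B)%MS.
Proof. by move=> AB; rewrite submxMr // map_submx. Qed.

Lemma eqmx_slin m1 m2 (A : 'M[F]_(m1, n)) (B : 'M[F]_(m2, n)) :
  (A :=: B)%MS -> (slin A :=: slin B)%MS.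
Proof. by move=> AB; apply/eqmxP; rewrite !slinS ?AB. Qed.

Lemma map_mx_surj m p (y : 'M[F]_(m, p)) : exists x, map_mx tau x = y.
Proof.
have [t' _ tK] := injF_bij (fmorph_inj tau).
by exists (map_mx t' y); apply/matrixP => i j; rewrite !mxE tK.
Qed.

Lemma slin_surj m (y : 'M[F]_(m, n)) : exists x, slin x = y.
Proof.
by have [x xE] := map_mx_surj (y *m invmx M); exists x; rewrite /slin xE mulmxKV.
Qed.

Lemma sub_slin m m' (x : 'M[F]_(m', n)) (A : 'M[F]_(m, n)) :
  (x <= slin A)%MS -> exists2 y : 'M[F]_(m', n), (y <= A)%MS & x = slin y.
Proof.
case/submxP=> D ->; have [D' <-] := map_mx_surj D.
by exists (D' *m A); rewrite ?submxMl // /slin map_mxM mulmxA.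
Qed.

Lemma slinD m (A B : 'M[F]_(m, n)) : slin (A + B) = slin A + slin B.
Proof. by rewrite /slin map_mxD mulmxDl. Qed.

Lemma rank_slin_cap m1 m2 (A : 'M[F]_(m1, n)) (B : 'M[F]_(m2, n)) :
  \rank (slin A :&: slin B)%MS = \rank (A :&: B)%MS.
Proof.
rewrite -(rank_slin (A :&: B)%MS); apply/eqmx_rank/andP; split; last first.
  by rewrite sub_capmx !slinS ?capmxSl ?capmxSr.
apply/rV_subP => x; rewrite sub_capmx => /andP[/sub_slin[y yA ->] /sub_slin[z zB]].
move/(can_inj (mulmxK Mu))/map_mx_inj => yz.
by apply: slinS; rewrite sub_capmx yA yz.
Qed.

End Semilinear.

Lemma mem_PGaL (g : {perm subsp F n}) : g \in PGaL F n ->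
  exists (tau : {rmorphism F -> F}) (M : 'M[F]_n), M \in unitmx /\
    forall m (A : 'M[F]_(m, n)), g (spn A) = spn (slin tau M A).
Proof.
rewrite inE => /existsP[s /existsP[M /and3P[/fieldautP[tau tauE] Mu /forallP gM]]].
exists tau, M; split=> // m A; rewrite (eqP (gM _)) spn_mksub -tauE.
by apply/spn_eqP; apply: (eqmx_slin tau M (val_spn A)).
Qed.

End SubspacePermutations.

(** * The socle and its normaliser *)

Section ClassicalGroup.
Local Open Scope ring_scope.
Variables (F : finFieldType) (n : nat) (k : ckind) (s : {ffun F -> F}) (B : 'M[F]_n).
Variables (sg : {rmorphism F -> F}) (eps : F) (T : F -> F).
Hypothesis sgE : (sg : F -> F) = sig_of k s.
Hypothesis geo : polar_geometry sg eps (polar k B) B T.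
Hypothesis isoP : same_isometries k s sg B.
Hypothesis n8 : (8 <= n)%N.

Local Notation P := (polar k B).
Local Notation beta := (sform sg P).
Local Notation q := (qform sg B).
Local Notation N := (ClSoc k s B).

(** Serves as the abstract [K]: vectors are moved by matrices, while membership in the socle is
    tested on the induced permutation, where scalars disappear. *)
Definition lift_soc (M : 'M[F]_n) : Prop := Defs.isom k s B M /\ pm M \in N.

Lemma isom_unit M : Defs.isom k s B M -> M \in unitmx.
Proof. by case/andP. Qed.

Lemma IsomImgP (g : {perm subsp F n}) :
  reflect (exists2 M, Defs.isom k s B M & g = pm M) (g \in IsomImg k s B).
Proof.
rewrite inE; apply: (iffP existsP) => [[M /andP[iM gM]]|[M iM ->]].
  by exists M => //; apply: induced_pm gM; apply: isom_unit.
by exists M; rewrite iM; apply: pm_induced; apply: isom_unit.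
Qed.

Lemma IsomImg_group : group_set (IsomImg k s B).
Proof.
apply/group_setP; split.
  apply/IsomImgP; exists 1%:M; rewrite ?pm1 //.
  by apply/isoP; apply: isometry1.
move=> _ _ /IsomImgP[M iM ->] /IsomImgP[M' iM' ->]; apply/IsomImgP.
exists (M *m M'); last by rewrite pmM ?isom_unit.
by apply/isoP; apply: isometry_mul; apply/isoP.
Qed.

Lemma mem_soc (g : {perm subsp F n}) : g \in N ->
  exists2 M, Defs.isom k s B M & g = pm M.
Proof.
move=> gN; apply/IsomImgP; rewrite -(gen_set_id IsomImg_group).
have : (N \subset <<IsomImg k s B>>)%g by rewrite commg_subl normG.
by move/subsetP; apply.
Qed.

Lemma lift_soc_isometry M : lift_soc M -> isometry_mx sg P B M.
Proof. by case=> /isoP. Qed.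

Lemma lift_soc_unit M : lift_soc M -> M \in unitmx.
Proof. by case=> /isom_unit. Qed.

Lemma lift_soc_mul M M' : lift_soc M -> lift_soc M' -> lift_soc (M *m M').
Proof.
move=> [iM pM] [iM' pM']; split; last by rewrite pmM ?isom_unit ?groupM.
by apply/isoP; apply: isometry_mul; apply/isoP.
Qed.

Lemma lift_soc_comm M M' : isometry_mx sg P B M -> isometry_mx sg P B M' ->
  lift_soc (invmx M *m (invmx M' *m M *m M')).
Proof.
move=> iM iM'; have Mu : M \in unitmx by case: iM.
have Mu' : M' \in unitmx by case: iM'.
have Vu : invmx M \in unitmx by rewrite unitmx_inv.
have Vu' : invmx M' \in unitmx by rewrite unitmx_inv.
split.
  apply/isoP; do ?apply: isometry_mul => //; exact: isometry_inv.
have MVu : invmx M' *m M \in unitmx by rewrite unitmx_mul Vu'.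
have MVMu : invmx M' *m M *m M' \in unitmx by rewrite unitmx_mul MVu.
rewrite (pmM Vu MVMu) (pmM MVu Mu') (pmM Vu' Mu) (pmV Mu) (pmV Mu') -mulgA.
by apply: mem_commg; apply: mem_gen; apply/IsomImgP;
  [exists M | exists M'] => //; apply/isoP.
Qed.

(** As [g] normalises the socle, the conjugate of [pm E] is [pm E0] with [E0] an isometry. The
    conjugated matrix [E1] agrees with [E0] on every line, so [E1 = c *: E0] multiplies [beta] by
    [c * sg c]; this is the factor that [perp_transport] asks for. *)
Lemma normaliser_perp (g : {perm subsp F n}) : g \in ('N(N))%g -> g \in PGaL F n ->
  exists (tau : {rmorphism F -> F}) (M : 'M[F]_n), [/\ M \in unitmx,
    forall m (A : 'M[F]_(m, n)), g (spn A) = spn (slin tau M A)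
    & forall x y, beta x y = 0 -> beta (slin tau M x) (slin tau M y) = 0].
Proof.
move=> gN /mem_PGaL[tau [M [Mu gM]]]; exists tau, M; split=> //.
apply: (perp_transport geo n8 (K := lift_soc)) => [||x y|E kE].
- exact: lift_soc_mul.
- exact: lift_soc_comm.
- exact: slinD.
have Eu := lift_soc_unit kE.
have [E0 iE0 E0E] : exists2 E0, Defs.isom k s B E0 & (pm E ^ g)%g = pm E0.
  by apply: mem_soc; rewrite memJ_norm //; case: kE.
have E0u := isom_unit iE0.
pose E1 := invmx M *m map_mx tau E *m M.
have thE m (x : 'M[F]_(m, n)) : slin tau M (x *m E) = slin tau M x *m E1.
  by rewrite /slin /E1 map_mxM !mulmxA mulmxK.
have lineE (y : 'rV[F]_n) : (y *m E1 :=: y *m E0)%MS.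
  have [x <-] := slin_surj tau Mu y.
  apply/spn_eqP; rewrite -(pm_spn _ E0u) -E0E -gM -[RHS]permM.
  by rewrite -conjgC permM (pm_spn _ Eu) gM thE.
have [c hc] : exists c, forall y : 'rV[F]_n, y *m (E1 *m invmx E0) = c *: y.
  apply: line_stable_scalar => y.
  have : (y *m E1 <= y *m E0)%MS by rewrite lineE.
  by case/sub_rVP => a ya; exists a; rewrite mulmxA ya -scalemxAl mulmxK.
have {}hc (y : 'rV[F]_n) : y *m E1 = c *: (y *m E0).
  by rewrite -(mulmxKV E0u (y *m E1)) -(mulmxA y E1) hc scalemxAl.
exists (c * sg c) => x y; rewrite !thE !hc sformZl sformZr mulrA.
by have [_ -> _] := (isoP E0).1 iE0.
Qed.

End ClassicalGroup.

(** * Orbital graphs *)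

Section OrbitalGraphs.
Variables (T : finType) (G : {group {perm T}}).
Implicit Types (x y u v w z : T).

Lemma orb_adjP x y u v :
  reflect (exists2 g, g \in G & (g x = u /\ g y = v) \/ (g x = v /\ g y = u))
    (orb_adj G x y u v).
Proof.
apply: (iffP exists_inP) => -[g gG h]; exists g => //.
  by case/orP: h => /andP[/eqP ? /eqP ?]; [left | right].
by apply/orP; case: h => -[-> ->]; [left | right]; rewrite !eqxx.
Qed.

Lemma orb_within1P x y u v : orb_within G x y 1 u v <-> u = v \/ orb_adj G x y u v.
Proof.
split=> [/orP[/eqP|/existsP[w /andP[/eqP ->]]]|[->|h]]; first by left.
- by right.
- by rewrite /= eqxx.
- by apply/orP; right; apply/existsP; exists u; rewrite /= eqxx.
Qed.

Lemma orb_within2P x y u v : orb_within G x y 2 u v <->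
  [\/ u = v, orb_adj G x y u v | exists2 w, orb_adj G x y u w & orb_adj G x y w v].
Proof.
rewrite [orb_within _ _ _ _ _ _]/(orb_within G x y 1 u v || _); split.
  case/orP=> [/orb_within1P[]|/existsP[w /andP[/orb_within1P[->|uw] wv]]];
  by [constructor 1 | constructor 2 | constructor 3; exists w].
case=> [uv|uv|[w uw wv]]; apply/orP.
- by left; apply/orb_within1P; left.
- by left; apply/orb_within1P; right.
- by right; apply/existsP; exists w; rewrite wv andbT; apply/orb_within1P; right.
Qed.

Lemma orbit_permP x0 x : reflect (exists2 g, g \in G & x = g x0) (x \in orbit 'P G x0).
Proof. by apply: (iffP imsetP) => -[g gG ->]; exists g. Qed.

(** Meant for [f] the perp map, which commutes with [G]; it lets a subspace be replaced by its
    perp. *)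
Lemma orb_diam_le_map (f : T -> T) x0 d : injective f ->
  (forall g, g \in G -> forall x, g (f x) = f (g x)) ->
  orb_diam_le G (orbit 'P G x0) d -> orb_diam_le G (orbit 'P G (f x0)) d.
Proof.
move=> f_inj fG.
have fadj x y u v : orb_adj G x y u v -> orb_adj G (f x) (f y) (f u) (f v).
  case/orb_adjP=> g gG h; apply/orb_adjP; exists g => //.
  by rewrite !fG //; case: h => -[-> ->]; [left | right].
have fwithin x y u v : orb_within G x y d u v -> orb_within G (f x) (f y) d (f u) (f v).
  elim: d v => [v /eqP -> //=|d IH v /= /orP[/IH -> //|/existsP[w /andP[/IH uw wv]]]].
  by apply/orP; right; apply/existsP; exists (f w); rewrite uw fadj.
move=> hd x y u v /orbit_permP[gx gxG ->] /orbit_permP[gy gyG ->].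
rewrite !fG // (inj_eq f_inj) => xy /orbit_permP[gu guG ->] /orbit_permP[gv gvG ->].
by rewrite !fG //; apply: fwithin; apply: hd => //; apply/orbit_permP;
  [exists gx | exists gy | exists gu | exists gv].
Qed.

End OrbitalGraphs.

(** * Diameters of orbital graphs of a classical group *)

Section ClassicalOrbitals.
Local Open Scope ring_scope.
Variables (F : finFieldType) (n : nat) (k : ckind) (s : {ffun F -> F}) (B : 'M[F]_n).
Variables (sg : {rmorphism F -> F}) (eps : F) (T : F -> F).
Hypothesis geo : polar_geometry sg eps (polar k B) B T.
Hypothesis isoP : same_isometries k s sg B.
Hypothesis n8 : (8 <= n)%N.
Variable G : {group {perm subsp F n}}.
Hypothesis GN : ClSoc k s B \subset G.

Local Notation P := (polar k B).
Local Notation beta := (sform sg P).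
Local Notation q := (qform sg B).
Local Notation prp := (prp sg P).
Local Notation lift_soc := (lift_soc k s B).
Implicit Types (x y z u v w e f : 'rV[F]_n) (U W X Y Z : subsp F n).

Hypothesis Gperp : forall g, g \in G ->
  exists (tau : {rmorphism F -> F}) (M : 'M[F]_n), [/\ M \in unitmx,
    forall m (A : 'M[F]_(m, n)), g (spn A) = spn (slin tau M A)
    & forall x y, beta x y = 0 -> beta (slin tau M x) (slin tau M y) = 0].

Let Punit := pg_unit geo.
Let beta_sym := beta_sym geo.
Let prpK := prpK geo.

Definition pp U : subsp F n := spn (prp (val U)).

Lemma pp_spn m (A : 'M[F]_(m, n)) : pp (spn A) = spn (prp A).
Proof. by apply/spn_eqP/eqmx_prp/val_spn. Qed.

Lemma ppK : involutive pp.
Proof. by move=> U; rewrite /pp -/(pp _) pp_spn -[RHS]spnK; apply/spn_eqP. Qed.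

Lemma rank_pp U : \rank (val (pp U)) = (n - \rank (val U))%N.
Proof. by rewrite (val_spn (prp (val U))) rank_prp. Qed.

Lemma G_pp (g : {perm subsp F n}) U : g \in G -> g (pp U) = pp (g U).
Proof.
case/Gperp=> tau [M [Mu gM perp]]; rewrite gM -{2}(spnK U) gM pp_spn; apply/spn_eqP.
have sub : (slin tau M (prp (val U)) <= prp (slin tau M (val U)))%MS.
  apply/rV_subP => x /sub_slin[y yU ->]; apply/sub_prpP => z /sub_slin[t tU ->].
  by apply: perp; move/sub_prpP: yU; apply.
by apply/eqmxP; rewrite -(mxrank_leqif_eq sub) !(rank_prp sg Punit, rank_slin).
Qed.

Lemma rank_G (g : {perm subsp F n}) U : g \in G -> \rank (val (g U)) = \rank (val U).
Proof.
by case/Gperp=> tau [M [Mu gM _]]; rewrite -{1}(spnK U) gM (val_spn _) rank_slin.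
Qed.

Lemma rank_capG (g : {perm subsp F n}) U W : g \in G ->
  \rank (val (g U) :&: val (g W))%MS = \rank (val U :&: val W)%MS.
Proof.
case/Gperp=> tau [M [Mu gM _]]; rewrite -{1}(spnK U) -{1}(spnK W) !gM.
by rewrite (cap_eqmx (val_spn _) (val_spn _)) rank_slin_cap.
Qed.

(** Makes the dimension of [U :&: prp W] an invariant of unordered edges. The perp of [U + prp W] is
    [W :&: prp U], so both dimensions follow from that of the sum. *)
Lemma rank_cap_pp_sym U W : \rank (val U) = \rank (val W) ->
  \rank (val U :&: val (pp W))%MS = \rank (val W :&: val (pp U))%MS.
Proof.
move=> rUW; have rs := mxrank_sum_cap (val U) (val (pp W)).
have : \rank (val W :&: val (pp U))%MS = (n - \rank (val U + val (pp W))%MS)%N.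
  rewrite -(rank_prp sg Punit) (cap_prp sg P) capmxC.
  apply/eqmx_rank/eqmxP/cap_eqmx; first exact: val_spn.
  exact: eqmx_sym (eqmx_trans (eqmx_prp sg P (val_spn _)) (prpK _)).
move: rs (rank_leq_col (val U + val (pp W))%MS) (rank_leq_col (val W)).
rewrite rank_pp rUW; lia.
Qed.

Lemma adj_rank_cap X Y Z W : orb_adj G X Y Z W ->
  \rank (val Z :&: val W)%MS = \rank (val X :&: val Y)%MS.
Proof.
case/orb_adjP=> g gG [[<- <-]|[<- <-]]; last rewrite capmxC; exact: rank_capG.
Qed.

Lemma adj_rank_cap_pp X Y Z W : orb_adj G X Y Z W -> \rank (val X) = \rank (val Y) ->
  \rank (val Z :&: val (pp W))%MS = \rank (val X :&: val (pp Y))%MS.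
Proof.
move=> + rXY; case/orb_adjP=> g gG [[<- <-]|[<- <-]].
  by rewrite -G_pp // rank_capG.
by rewrite -G_pp // rank_capG // rank_cap_pp_sym.
Qed.

Lemma adj_rank X Y Z W : orb_adj G X Y Z W -> \rank (val X) = \rank (val Y) ->
  \rank (val Z) = \rank (val X) /\ \rank (val W) = \rank (val X).
Proof.
by move=> + rXY; case/orb_adjP=> g gG [[<- <-]|[<- <-]]; rewrite !rank_G.
Qed.

Lemma rank_cap_val_pp U m (A : 'M[F]_(m, n)) :
  \rank (A :&: val (pp U))%MS = \rank (A :&: prp (val U))%MS.
Proof. by have [-> _] := cap_eqmx (eqmx_refl A) (val_spn (prp (val U))). Qed.

(* The edge joins [U] to its image [W] under the Siegel transformation with
   parameters [e] in the perp of [U] and [f] in [U]: then [U] meets the perp of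
   [W] trivially while [U :&: W] has codimension 1 in [U].  A neighbour [Z] of
   [U3] meets [U3 :&: prp U], hence [prp U], so that it is not a neighbour of [U]. *)
Lemma diam_gt2 (x0 : subsp F n) : \rank (val x0 :&: prp (val x0))%MS = 0 ->
  (2 <= \rank (val x0))%N -> (\rank (val x0) + 4 <= n)%N ->
  ~ orb_diam_le G (orbit 'P G x0) 2.
Proof.
set U := val x0 => nd r2 r4 diam.
have ndU (x : 'rV[F]_n) : (x <= U)%MS -> (x <= prp U)%MS -> x = 0.
  move=> xU xU'; apply/eqP; rewrite -submx0.
  by move/eqP: nd; rewrite mxrank_eq0 => /eqP <-; rewrite sub_capmx xU.
have mem M : lift_soc M -> pm M x0 \in orbit 'P G x0.
  by case=> _ MN; apply/orbit_permP; exists (pm M); rewrite ?(subsetP GN).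
have x0X : x0 \in orbit 'P G x0 by apply/orbit_permP; exists 1%g; rewrite ?perm1.
have [|e [d [eU dU qe de]]] := isotropic_ex geo (S := U).
  by rewrite nd; lia.
have e0 : e != 0 by apply: contraNneq de => ->; rewrite sform0r.
have [f fU f0] : exists2 f : 'rV[F]_n, (f <= U)%MS & f != 0.
  have [|f fU h] := @rank_gt_ex _ _ _ _ U (0 : 'rV[F]_n).
    by rewrite mxrank0; apply: leq_trans r2.
  by exists f => //; apply: contraNneq h => ->; rewrite sub0mx.
have Ue (y : 'rV[F]_n) : (y <= U)%MS -> beta y e = 0.
  by move=> yU; apply: beta_sym; move/sub_prpP: eU; apply.
have [c qf] := pg_surj geo f.
pose E := siegel sg eps P e f c.
have kE : lift_soc E.
  apply: (mem_K_siegel geo n8 (K := lift_soc)) => //.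
  - exact: lift_soc_mul.
  - exact: lift_soc_comm.
  - by split=> //; apply: beta_sym; apply: Ue.
have Eu := lift_soc_unit kE.
have yE (y : 'rV[F]_n) : (y <= U)%MS -> y *m E = y - (eps * beta y f) *: e.
  by move=> yU; rewrite siegelE Ue // mulr0 !scale0r subr0 addr0.
pose W := pm E x0.
have WE : W = spn (U *m E) by rewrite /W pmE.
(* On [U] the transformation adds only multiples of [e], which is orthogonal to [U]; a vector of [U]
   orthogonal to [W] is thus orthogonal to [U]. *)
have UW0 : \rank (U :&: val (pp W))%MS = 0.
  rewrite rank_cap_val_pp; apply/eqP; rewrite mxrank_eq0 -submx0.
  apply/rV_subP => x; rewrite sub_capmx => /andP[xU xW]; rewrite submx0; apply/eqP.
  apply: ndU => //; apply/sub_prpP => y yU; move/sub_prpP: xW => /(_ (y *m E)).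
  rewrite WE (val_spn _) submxMr // yE // sformBr sformZr (Ue x) // mulr0 subr0.
  exact.
have UW1 : (\rank U <= \rank (U :&: val W)%MS + 1)%N.
  have sub : (U :&: prp f <= U :&: val W)%MS.
    apply/rV_subP => y; rewrite sub_capmx (prp_rV _ _ y) => /andP[yU /eqP yf].
    rewrite sub_capmx yU WE (val_spn _).
    have -> : y = y *m E by rewrite yE // yf mulr0 scale0r subr0.
    by rewrite submxMr.
  have h1 := mxrankS sub; have := rank_cap_ge U (prp f).
  by rewrite (rank_prp sg Punit) (rank_rV f) f0 => h2; clear -h1 h2 n8; lia.
(* Otherwise [U] would contain a nonzero multiple of [e], which lies in the perp of [U]. *)
have x0W : x0 != W.
  apply/eqP => x0W; have fU' : ~~ (f <= prp U)%MS.
    by apply: contra f0 => /(ndU _ fU) ->.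
  have [y yU fy] := not_prp_ex fU'.
  have : (y *m E <= U)%MS by rewrite /U x0W WE (val_spn _) submxMr.
  rewrite yE // => yEU; case/eqP: e0; apply: ndU => //.
  have t0 : eps * beta y f != 0.
    rewrite mulf_neq0 //; last by rewrite (beta_sym0 geo).
    by apply: contra_eq_neq (pg_eps2 geo) => ->; rewrite mul0r eq_sym oner_eq0.
  rewrite -[e]scale1r -(mulVf t0) -scalerA scalemx_sub //.
  have -> : (eps * beta y f) *: e = y - (y - (eps * beta y f) *: e).
    by rewrite opprB addrC subrK.
  by rewrite addmx_sub ?eqmx_opp.
have rW : \rank U = \rank (val W) by rewrite WE (val_spn _) mxrankMfree ?row_free_unit.
(* [U3] is the image of [U] under an element of the socle that sends a plane of [U] into the perp of
   [U]. *)
have [a [b [a' [b' [[aU bU a0 ba] [aU' bU' a0' ba'] [qa qb ab]]]]]] := gram_copy_ex geo n8 nd r2 r4.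
have [M [kM aM bM]] := witt_move_pair geo n8 (lift_soc_isometry isoP)
  (lift_soc_mul isoP) (lift_soc_comm isoP) qa qb ab a0 a0' ba ba'.
pose U3 := pm M x0.
have U3E : U3 = spn (U *m M) by rewrite /U3 pmE // (lift_soc_unit kM).
have U3U : (2 <= \rank (val U3 :&: prp U)%MS)%N.
  have sub : (col_mx a' b' <= val U3 :&: prp U)%MS.
    by rewrite sub_capmx U3E (val_spn _) !col_mx_sub aU' bU' -aM -bM !submxMr.
  apply: leq_trans (mxrankS sub); rewrite -addsmxE.
  have ra : (\rank a' = 1)%N by rewrite rank_rV a0'.
  have : (a' < a' + b')%MS.
    by rewrite /ltmx addsmxSl addsmx_sub submx_refl.
  by move/rank_ltmx; rewrite ra.
have adjU A C : orb_adj G x0 W A C ->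
  [/\ (\rank (val A :&: val C)%MS + 1 >= \rank U)%N,
      \rank (val A :&: val (pp C))%MS = 0, \rank (val C :&: val (pp A))%MS = 0
    & \rank (val C) = \rank U].
  move=> adj; have [rA rC] := adj_rank adj rW.
  rewrite (adj_rank_cap adj) (rank_cap_pp_sym (U := C)) ?rA ?rC //.
  by rewrite (adj_rank_cap_pp adj rW); split.
have /orb_within2P := diam _ _ _ _ x0X (mem _ kE) x0W x0X (mem _ kM).
rewrite -/U3; case=> [x0U3|adj|[Z adj1 adj2]].
- by move: U3U; rewrite -x0U3 nd.
- by have [_ _ h _] := adjU _ _ adj; move: U3U; rewrite rank_cap_val_pp in h; rewrite h.
have [_ _ h1 _] := adjU _ _ adj1; have [h2 _ _ rU3] := adjU _ _ adj2.
rewrite rank_cap_val_pp -/U in h1.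
have sub : (val Z :&: val U3 :&: (val U3 :&: prp U) <= val Z :&: prp U)%MS.
  by rewrite sub_capmx; apply/andP; split; apply/rV_subP => x; rewrite !sub_capmx;
    case/andP=> /andP[? ?] /andP[? ?].
have := mxrankS sub; rewrite h1.
have := mxrank_sum_cap (val Z :&: val U3)%MS (val U3 :&: prp U)%MS.
have : (val Z :&: val U3 + (val U3 :&: prp U) <= val U3)%MS.
  by rewrite addsmx_sub capmxSr capmxSl.
move/mxrankS; rewrite rU3 => h3 h4 h5; clear -h2 h3 h4 h5 U3U; lia.
Qed.

Lemma sform_pair_ex u v (l : F) : u != 0 -> ~~ (v <= u)%MS ->
  exists w, beta u w = l /\ beta v w = l.
Proof.
move=> u0 vu; set S := col_mx u v.
have Sfree : row_free (S *m P).
  rewrite /row_free mxrankMfree ?row_free_unit // eqn_leq rank_leq_row.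
  have : (u < u + v)%MS by rewrite /ltmx addsmxSl addsmx_sub submx_refl.
  by move/rank_ltmx; rewrite addsmxE rank_rV u0.
pose w : 'rV[F]_n := (pinvmx (S *m P) *m const_mx l)^T.
exists (map_mx sg w).
have sgw : map_mx sg (map_mx sg w) = w.
  by apply/matrixP => i j; rewrite !mxE (pg_sgK geo).
have SE : S *m P *m w^T = const_mx l by rewrite trmxK mulmxA mulmxVp // mul1mx.
rewrite /sform sgw; move: SE; rewrite /S !mul_col_mx -col_mx_const.
by case/eq_col_mx => -> ->; rewrite !mxE.
Qed.

Lemma witt_orb_adj x y u w : q x = q u -> q y = q w -> beta x y = beta u w ->
  x != 0 -> u != 0 -> ~~ (y <= x)%MS -> ~~ (w <= u)%MS ->
  exists2 g, g \in G & g (spn x) = spn u /\ g (spn y) = spn w.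
Proof.
move=> qx qy xy x1 u0 yx wu.
have [M [kM xM yM]] := witt_move_pair geo n8 (lift_soc_isometry isoP)
  (lift_soc_mul isoP) (lift_soc_comm isoP) qx qy xy x1 u0 yx wu.
exists (pm M); first by apply: (subsetP GN); case: kM.
by rewrite !pm_spn ?(lift_soc_unit kM) // xM yM.
Qed.

(** A common neighbour of [u] and [v] in the graph of [a], [b] is a [w] outside their span, with the
    right value of [q], whose products with [u] and [v] both equal [beta a b]: Witt's theorem
    carries [(a, b)] to [(u, w)] and to [(v, w)]. The diameter is not 1 because both orthogonal and
    non-orthogonal pairs of distinct points occur in [X]. *)
Lemma diam_point_eq2 x : x != 0 ->
  (forall U, U \in orbit 'P G (spn x) -> exists2 M, lift_soc M & U = pm M (spn x)) ->
  orb_diam_eq G (orbit 'P G (spn x)) 2.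
Proof.
move=> x1 trans.
have rep U : U \in orbit 'P G (spn x) -> exists u, [/\ U = spn u, u != 0 & q u = q x].
  case/trans=> M kM ->; exists (x *m M).
  have [Mu _ Mq] := lift_soc_isometry isoP kM.
  rewrite pm_spn // Mq; split=> //; apply: contraNneq x1 => xM0.
  by rewrite -[x](mulmxK Mu) xM0 mul0mx.
split=> [X Y U W /rep[a [-> a0 qa]] /rep[b [-> b0 qb]] ab /rep[u [-> u0 qu]] /rep[v [-> v0 qv]]|].
  have ba : ~~ (b <= a)%MS.
    apply: contra ab => /sub_rVP[t bE]; apply/eqP/esym/spn_eqP; rewrite bE.
    by apply: eqmx_scale; apply: contraNneq b0 => t0; rewrite bE t0 scale0r.
  apply/orb_within2P; have [vu|vu] := boolP (v <= u)%MS.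
    constructor 1; apply/esym/spn_eqP; case/sub_rVP: vu => t vE; rewrite vE.
    by apply: eqmx_scale; apply: contraNneq v0 => t0; rewrite vE t0 scale0r.
  constructor 3.
  have [w0 [uw0 vw0]] := sform_pair_ex (beta a b) u0 vu.
  have [|w [wS qw wS']] := @vector_ex _ _ _ _ _ _ _ geo _ (col_mx u v) w0 x.
    have := mxrankS (capmxSl (col_mx u v) (prp (col_mx u v))).
    by have := rank_col2 u v => h1 h2; clear -h1 h2 n8; lia.
  move: wS; rewrite prp_col2 => /andP[/eqP uw /eqP vw].
  have bw z : beta (w - w0) z = 0 -> beta z w = beta z w0.
    by move/beta_sym/eqP; rewrite sformBr subr_eq0 => /eqP.
  rewrite -addsmxE in wS'.
  exists (spn w); apply/orb_adjP.
    have [|||||||g gG [gx gy]] := @witt_orb_adj a b u w; rewrite ?qa ?qu ?qb ?qw // ?bw //.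
      by apply: contra wS' => h; apply: submx_trans (addsmxSl _ _).
    by exists g => //; left.
  have [|||||||g gG [gx gy]] := @witt_orb_adj a b v w; rewrite ?qa ?qv ?qb ?qw // ?bw //.
    by apply: contra wS' => h; apply: submx_trans (addsmxSr _ _).
  by exists g => //; right.
have rS : (\rank x + \rank (x :&: prp x)%MS + 3 <= n)%N.
  have := mxrankS (capmxSl x (prp x)).
  by have := rank_leq_row x => h1 h2; clear -h1 h2 n8; lia.
have [y [yx qy yx']] := vector_ex geo 0 x rS; rewrite subr0 in yx.
have [d _ xd] : exists2 d, (d <= (1%:M : 'M[F]_n))%MS & beta x d != 0.
  apply: (not_prp_ex (sg := sg)); apply: contra x1 => h.
  suff : (x <= (0 : 'M[F]_n))%MS by rewrite submx0.
  suff /eqP <- : prp (1%:M : 'M[F]_n) == 0 by [].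
  by rewrite -mxrank_eq0 rank_prp // mxrank1 subnn.
have [z [zx qz zx']] := vector_ex geo d x rS.
have xz : beta x z != 0.
  suff -> : beta x z = beta x d by [].
  apply/eqP; rewrite -subr_eq0 -sformBr; apply/eqP/beta_sym.
  by move: zx; rewrite (prp_rV _ _ (z - d)) => /eqP.
have mem u : q u = q x -> ~~ (u <= x)%MS -> spn u \in orbit 'P G (spn x).
  move=> qu ux; have u0 : u != 0 by apply: contraNneq ux => ->; rewrite sub0mx.
  have [M kM xM] := witt_move0 geo n8 (lift_soc_mul isoP) (lift_soc_comm isoP)
    (esym qu) x1 u0.
  apply/orbit_permP; exists (pm M); first by apply: (subsetP GN); case: kM.
  by rewrite pm_spn ?xM // (lift_soc_unit kM).
have neq u : ~~ (u <= x)%MS -> spn x <> spn u by move=> ux /spn_eqP xu; rewrite xu submx_refl in ux.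
have xX : spn x \in orbit 'P G (spn x) by apply/orbit_permP; exists 1%g; rewrite ?perm1.
have r1 u : ~~ (u <= x)%MS -> \rank (val (spn u)) = 1%N.
  by move=> ux; rewrite (val_spn u) rank_rV; case: eqP ux => // ->; rewrite sub0mx.
have rx : \rank (val (spn x)) = 1%N by rewrite (val_spn x) rank_rV x1.
have xy0 : spn x != spn y by apply/eqP/neq.
move=> diam; have /orb_within1P := diam _ _ _ _ xX (mem _ qy yx') xy0 xX (mem _ qz zx').
case=> [/neq//|adj].
have := adj_rank_cap_pp adj; rewrite rx r1 // => /(_ erefl).
have capE u : \rank (val (spn x) :&: val (pp (spn u)))%MS = \rank (x :&: prp u)%MS.
  by rewrite pp_spn; have [-> _] := cap_eqmx (val_spn x) (val_spn (prp u)).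
rewrite !capE => rzy; case/negP: xz; rewrite -prp_rV.
have : (x <= x :&: prp y)%MS.
  by rewrite sub_capmx submx_refl (prp_rV _ _ x) (beta_sym0 geo) -(prp_rV _ _ y).
move/mxrankS; rewrite -rzy => r1z.
have [_ h] := mxrank_leqif_sup (capmxSl x (prp z)).
have : (x <= x :&: prp z)%MS by rewrite -h eqn_leq r1z mxrankS ?capmxSl.
by rewrite sub_capmx => /andP[].
Qed.

Lemma orb_diam_le_pp (x0 : subsp F n) d :
  orb_diam_le G (orbit 'P G (pp x0)) d <-> orb_diam_le G (orbit 'P G x0) d.
Proof.
have pG g : g \in G -> forall X, g (pp X) = pp (g X) by move=> gG X; apply: G_pp.
split=> [|h]; last exact: orb_diam_le_map (inv_inj ppK) pG h.
by move/(orb_diam_le_map (inv_inj ppK) pG); rewrite ppK.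
Qed.

(** Since [n >= 8], the subspace or its perp has codimension at least 4, and [diam_gt2] forbids that
    one to have dimension 2 or more. *)
Lemma diam_le2_rank (x0 : subsp F n) : \rank (val x0 :&: prp (val x0))%MS = 0 ->
  (0 < \rank (val x0) < n)%N -> orb_diam_le G (orbit 'P G x0) 2 ->
  minn (\rank (val x0)) (n - \rank (val x0)) = 1%N.
Proof.
move=> nd /andP[r0 rn] diam; have [r1|r1] := leqP (\rank (val x0)) 1.
  by clear -r0 r1 n8; lia.
have [r4|r4] := leqP (\rank (val x0) + 4) n; first by case: (diam_gt2 nd r1 r4 diam).
have [rn1|rn1] := leqP (n - \rank (val x0)) 1; first by clear -rn rn1 r1; lia.
case: (@diam_gt2 (pp x0)); rewrite ?rank_pp ?orb_diam_le_pp //.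
- have [-> _] := cap_eqmx (val_spn (prp (val x0))) (eqmx_prp sg P (val_spn (prp (val x0)))).
  by have [-> _] := cap_eqmx (eqmx_refl (prp (val x0))) (prpK (val x0)); rewrite capmxC.
- by clear -r4 n8; lia.
Qed.

Hypothesis NG : G \subset ('N(ClSoc k s B))%g.

(** A normal subgroup of a primitive group is transitive or acts trivially, and [pm M] moves [x0].
    The gain is that members of [X] are related by isometries, which keep the values of [q], and not
    merely by semilinear maps. *)
Lemma soc_transitive (x0 : subsp F n) (M : 'M[F]_n) :
  [primitive G, on orbit 'P G x0 | 'P]%g -> lift_soc M -> pm M x0 != x0 ->
  forall X, X \in orbit 'P G x0 -> exists2 M', lift_soc M' & X = pm M' x0.
Proof.
move=> prim [_ MN] Mx0.
have x0X : x0 \in orbit 'P G x0 by apply/orbit_permP; exists 1%g; rewrite ?perm1.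
have nN : (ClSoc k s B <| G)%g by rewrite /normal GN.
have [/subsetP/(_ _ MN)|trans X] := prim_trans_norm prim nN.
  rewrite inE => /andP[_ /astab_act /(_ x0X)].
  by rewrite /= apermE => /eqP; rewrite (negPf Mx0).
rewrite -(atransP trans x0 x0X) => /imsetP[h hN ->].
by have [M' iM' hE] := mem_soc isoP hN; exists M'; [split; rewrite -?hE | rewrite -hE].
Qed.

Lemma diam_eq2 (x0 : subsp F n) : [primitive G, on orbit 'P G x0 | 'P]%g ->
  minn (\rank (val x0)) (n - \rank (val x0)) = 1%N ->
  orb_diam_eq G (orbit 'P G x0) 2.
Proof.
move=> prim r1.
(* A hyperplane is the perp of a point, so [pp] reduces the claim to points. *)
have [x [x1 x0E]] : exists x : 'rV[F]_n, x != 0 /\ (x0 = spn x \/ x0 = pp (spn x)).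
  have rank1 (U : subsp F n) : \rank (val U) = 1%N -> exists2 x : 'rV[F]_n, x != 0 & U = spn x.
    move=> rU; have [|x xU x0'] := @rank_gt_ex _ _ _ _ (val U) (0 : 'rV[F]_n).
      by rewrite mxrank0 rU.
    have xn0 : x != 0 by apply: contraNneq x0' => ->; rewrite sub0mx.
    exists x => //; apply: spn_eq; apply/eqmx_sym/eqmxP.
    by rewrite -(mxrank_leqif_eq xU) rU rank_rV xn0.
  have [r|r] := eqVneq (\rank (val x0)) 1%N.
    by have [x xn0 ->] := rank1 _ r; exists x; split=> //; left.
  have [|x xn0 xE] := rank1 (pp x0); first by rewrite rank_pp; clear -r r1; lia.
  by exists x; split=> //; right; rewrite -xE ppK.
have rS : (\rank x + \rank (x :&: prp x)%MS + 3 <= n)%N.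
  have := mxrankS (capmxSl x (prp x)).
  by have := rank_leq_row x => h1 h2; clear -h1 h2 n8; lia.
have [y [_ qy yx]] := vector_ex geo 0 x rS.
have y0 : y != 0 by apply: contraNneq yx => ->; rewrite sub0mx.
have [M kM xM] := witt_move0 geo n8 (lift_soc_mul isoP) (lift_soc_comm isoP) (esym qy) x1 y0.
have MG : pm M \in G by apply: (subsetP GN); case: kM.
have Mx : pm M (spn x) != spn x.
  rewrite pm_spn ?(lift_soc_unit kM) // xM; apply/eqP => /spn_eqP xy.
  by rewrite -xy submx_refl in yx.
have Mx0 : pm M x0 != x0.
  by case: x0E => ->; rewrite ?G_pp // (inj_eq (inv_inj ppK)).
have trans := soc_transitive prim kM Mx0.
case: x0E => x0E; first by rewrite x0E; apply: diam_point_eq2 => //; rewrite -x0E.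
rewrite /orb_diam_eq x0E !orb_diam_le_pp; apply: diam_point_eq2 => // U /orbit_permP[g gG UE].
have [|M' kM' ppU] := trans (pp U).
  by apply/orbit_permP; exists g; rewrite // UE x0E G_pp.
exists M' => //; apply: (inv_inj ppK); rewrite ppU x0E G_pp //.
by apply: (subsetP GN); case: kM'.
Qed.

End ClassicalOrbitals.

(** * Case (b): classical groups other than PSL *)

Section CaseB.
Variables (F : finFieldType) (n : nat) (k : ckind) (s : {ffun F -> F}) (B : 'M[F]_n).
Variables (G : {group {perm subsp F n}}) (x0 : subsp F n).
Hypotheses (n8 : (8 <= n)%N) (stdG : std_b k s B G x0).

Let d := \rank (val x0).

Lemma std_b_diam_le2 : orb_diam_le G (orbit 'P G x0) 2 -> minn d (n - d) = 1%N.
Proof.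
case: stdG => formB [NG [GN [GP [_ [_ [rd nd]]]]]] diam.
case: nd => [nd|[_ [_ /andP[/eqP r1 _]]]]; last by rewrite /d r1; clear -n8; lia.
have [sg [eps [T [sgE geo isoP]]]] := form_geometry formB.
apply: (diam_le2_rank geo isoP n8 NG) => // [g gG|].
  exact: (normaliser_perp geo isoP n8 (subsetP GN _ gG) (subsetP GP _ gG)).
by apply/eqP; rewrite mxrank_eq0; move: nd; rewrite /nondeg /perpB -sgE.
Qed.

Lemma std_b_diam_eq2 : minn d (n - d) = 1%N -> orb_diam_eq G (orbit 'P G x0) 2.
Proof.
case: stdG => formB [NG [GN [GP [prim _]]]].
have [sg [eps [T [sgE geo isoP]]]] := form_geometry formB.
apply: (diam_eq2 geo isoP n8 NG) => // g gG.
exact: (normaliser_perp geo isoP n8 (subsetP GN _ gG) (subsetP GP _ gG)).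
Qed.

End CaseB.

(** * Transvections lie in PSL *)

Section TransvectionsInSocle.
Local Open Scope ring_scope.
Variables (F : finFieldType) (n : nat).
Implicit Types (M N : 'M[F]_n) (c : 'cV[F]_n) (r x : 'rV[F]_n).

Definition set_perm (T : finType) (h : {perm T}) : {perm {set T}} :=
  perm (imset_inj (@perm_inj T h)).

Lemma set_permE (T : finType) (h : {perm T}) (Q : {set T}) : set_perm h Q = h @: Q.
Proof. by rewrite permE. Qed.

Lemma set_permM (T : finType) (g h : {perm T}) :
  set_perm (g * h)%g = (set_perm g * set_perm h)%g.
Proof.
apply/permP => Q; rewrite permM !set_permE -imset_comp.
by apply: eq_imset => x; rewrite permM.
Qed.

Lemma set_permV (T : finType) (h : {perm T}) : set_perm h^-1%g = (set_perm h)^-1%g.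
Proof.
apply/esym/eqP; rewrite eq_invg_mul -set_permM mulgV; apply/eqP/permP => Q.
by rewrite set_permE perm1 (eq_imset _ (@perm1 T)) imset_id.
Qed.

Definition lift_psl M : Prop := M \in unitmx /\ set_perm (pm M) \in PSLsoc F n.

Lemma lift_psl_mul M N : lift_psl M -> lift_psl N -> lift_psl (M *m N).
Proof.
move=> [Mu pM] [Nu pN]; split; first by rewrite unitmx_mul Mu.
by rewrite (pmM Mu Nu) set_permM groupM.
Qed.

Lemma act2_idE M (U : subsp F n) : M \in unitmx -> act2 (idf F) M false U = pm M U.
Proof. by move=> Mu; rewrite pmE // /act2 map_idf spn_mksub. Qed.

Lemma mem_GLimg2 M : M \in unitmx -> set_perm (pm M) \in GLimg2 F n.
Proof.
move=> Mu; rewrite inE; apply/existsP; exists M; rewrite Mu; apply/forallP => Q.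
by rewrite set_permE; apply/eqP/eq_imset => U; rewrite act2_idE.
Qed.

Lemma lift_psl_comm M N : M \in unitmx -> N \in unitmx ->
  lift_psl (invmx M *m (invmx N *m M *m N)).
Proof.
move=> Mu Nu.
have Mu' : invmx M \in unitmx by rewrite unitmx_inv.
have Nu' : invmx N \in unitmx by rewrite unitmx_inv.
have NMu : invmx N *m M \in unitmx by rewrite unitmx_mul Nu'.
have NMNu : invmx N *m M *m N \in unitmx by rewrite unitmx_mul NMu.
split; first by rewrite unitmx_mul Mu'.
rewrite (pmM Mu' NMNu) (pmM NMu Nu) (pmM Nu' Mu) (pmV Mu) (pmV Nu).
rewrite !(set_permM, set_permV) -mulgA.
by apply: mem_commg; apply: mem_gen; apply: mem_GLimg2.
Qed.

Definition tv c r : 'M[F]_n := 1%:M + c *m r.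

Lemma tvE x c r : x *m tv c r = x + (x *m c) 0 0 *: r.
Proof. by rewrite mulmxDr mulmx1 mulmxA [x *m c]mx11_scalar mul_scalar_mx !mxE. Qed.

Lemma tvDr c r r' : r *m c = 0 -> tv c r *m tv c r' = tv c (r + r').
Proof.
move=> rc; apply: eqmx_mulrV => x; rewrite mulmxA !tvE mulmxDl -scalemxAl rc.
by rewrite scaler0 addr0 scalerDr addrA.
Qed.

Lemma tvK c r : r *m c = 0 -> tv c r *m tv c (- r) = 1%:M.
Proof. by move=> rc; rewrite tvDr // subrr /tv mulmx0 addr0. Qed.

Lemma tv_unit c r : r *m c = 0 -> tv c r \in unitmx.
Proof. by move/tvK/mulmx1_unit => []. Qed.

Lemma tvV c r : r *m c = 0 -> invmx (tv c r) = tv c (- r).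
Proof. by move=> rc; rewrite -[RHS](mulKmx (tv_unit rc)) tvK // mulmx1. Qed.

Lemma covector_ex m (U : 'M[F]_(m, n)) x : ~~ (x <= U)%MS ->
  exists2 c : 'cV[F]_n, U *m c = 0 & (x *m c) 0 0 = 1.
Proof.
rewrite submxE => xU.
have [j xj] : exists j, (x *m cokermx U) 0 j != 0.
  apply/existsP; apply: contraNT xU => /existsPn h.
  by apply/eqP/rowP => j; rewrite [RHS]mxE; apply/eqP; move: (h j); rewrite negbK.
have mul_col p (A : 'M[F]_(p, n)) : A *m col j (cokermx U) = col j (A *m cokermx U).
  by rewrite !colE mulmxA.
exists (((x *m cokermx U) 0 j)^-1 *: col j (cokermx U)).
  by rewrite -scalemxAr mul_col mulmx_coker colE mul0mx scaler0.
rewrite -scalemxAr mul_col; move: (x *m cokermx U) xj => v vj.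
by rewrite !mxE mulVf.
Qed.

Hypothesis n3 : (3 <= n)%N.

(** The relation [[E_ij, E_jk] = E_ik] of elementary matrices without coordinates: [r1] in the
    kernel of [c] plays the middle index, and the covector [c0] kills [r] and takes the value 1 at
    [r1]. Dimension 3 leaves room for [r1] outside the line of [r]. *)
Lemma lift_psl_tv c r : r *m c = 0 -> lift_psl (tv c r).
Proof.
move=> rc.
have [r1 r1c r1r] : exists2 r1 : 'rV[F]_n, r1 *m c = 0 & ~~ (r1 <= r)%MS.
  have [|r1 /sub_kermxP r1c r1r] := @rank_gt_ex _ _ _ _ (kermx c) r; last by exists r1.
  have := rank_leq_row r; have := rank_leq_col c; rewrite mxrank_ker => h1 h2.
  by clear -h1 h2 n3; lia.
have [c0 rc0 r1c0] := covector_ex r1r.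
set M := tv c (- r1); set N := tv c0 (- r).
have Nr1 : - r1 *m c = 0 by rewrite mulNmx r1c oppr0.
have Nrc : - r *m c = 0 by rewrite mulNmx rc oppr0.
have Nr : - r *m c0 = 0 by rewrite mulNmx rc0 oppr0.
suff <- : invmx M *m (invmx N *m M *m N) = tv c r by apply: lift_psl_comm; apply: tv_unit.
rewrite /M /N !tvV // !opprK.
apply: eqmx_mulrV => x; rewrite !mulmxA !tvE !(mulmxDl, mulNmx) -!scalemxAl.
rewrite r1c ?rc rc0 !(scaler0, oppr0, addr0, subr0).
have r10 : r1 *m c0 = 1%:M by rewrite [LHS]mx11_scalar r1c0.
rewrite mulNmx r10; move: (x *m c) (x *m c0) => a b.
by apply/rowP => i; rewrite !mxE /=; ring.
Qed.

End TransvectionsInSocle.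

(** * Case (c): pairs of subspaces under a graph automorphism *)

Section CaseC.
Local Open Scope ring_scope.
Variables (F : finFieldType) (n : nat).
Implicit Types (M : 'M[F]_n) (c : 'cV[F]_n) (x u w z : 'rV[F]_n) (A C U W : subsp F n).

(** Since each [g] acts by taking images under a map of points, every edge of the graph of [Q], [Q']
    joins sets that meet; a common neighbour of [P1] and [P3] has just two elements, hence one in
    each. *)
Lemma diam_gt2_share (T : finType) (G : {group {perm {set T}}}) (P0 Q Q' P1 P3 : {set T}) :
  let X := orbit 'P G P0 in
  (forall g, g \in G -> exists f : T -> T, forall Z, g Z = f @: Z) ->
  (forall Z, Z \in X -> #|Z| = 2) ->
  Q \in X -> Q' \in X -> P1 \in X -> P3 \in X ->
  Q != Q' -> Q :&: Q' != set0 -> P1 :&: P3 = set0 ->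
  (forall a b, a \in P1 -> b \in P3 -> [set a; b] \notin X) ->
  ~ orb_diam_le G X 2.
Proof.
move=> X Gf X2 QX QX' PX1 PX3 QQ' QI PI h diam.
have XG g Z : g \in G -> Z \in X -> g Z \in X.
  move=> gG /orbit_permP[g' gG' ->]; apply/orbit_permP; exists (g' * g)%g.
    exact: groupM.
  by rewrite permM.
have adj Z Z' : orb_adj G Q Q' Z Z' -> Z' \in X /\ Z :&: Z' != set0.
  case/set0Pn: QI => t; rewrite inE => /andP[tQ tQ'].
  case/orb_adjP=> g gG; have [f gf] := Gf g gG.
  have tI : f t \in g Q :&: g Q' by rewrite !gf inE !imset_f.
  by case=> -[<- <-]; split; rewrite ?XG //; apply/set0Pn; exists (f t); rewrite // setIC.
have /orb_within2P := diam _ _ _ _ QX QX' QQ' PX1 PX3.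
case=> [e|/adj[_]|[Z /adj[ZX /set0Pn[a]] + /adj[_ /set0Pn[b]]]].
- by have := X2 _ PX1; rewrite -[P1]setIid {2}e PI cards0.
- by rewrite PI eqxx.
rewrite !inE => /andP[aP aZ] /andP[bZ bP].
have ab : a != b.
  apply/eqP => ab; have : a \in P1 :&: P3 by rewrite inE aP ab.
  by rewrite PI inE.
suff ZE : [set a; b] = Z by have := h _ _ aP bP; rewrite ZE ZX.
by apply/eqP; rewrite eqEcard subUset !sub1set aZ bZ cards2 ab X2.
Qed.

Lemma pair_eq_cases (T : finType) (a b c d : T) : a != b -> [set a; b] = [set c; d] ->
  (c = a /\ d = b) \/ (c = b /\ d = a).
Proof.
move=> ab e; have ac : a \in [set c; d] by rewrite -e set21.
have bc : b \in [set c; d] by rewrite -e set22.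
move: ac bc; rewrite !inE => /orP[]/eqP aE /orP[]/eqP bE; subst; rewrite ?eqxx // in ab *.
  by left.
by right.
Qed.

Variables (inc : bool) (t : nat).

(** [inc] separates flags from decompositions of [V]. The order of the arguments matters: a graph
    automorphism exchanges the two dimensions and thus reverses the pair. *)
Definition linked A C : Prop := [/\ \rank (val A) = t, \rank (val C) = (n - t)%N
  & if inc then (val A <= val C)%MS else \rank (val A :&: val C)%MS == 0%N].

Hypothesis tn : (t < n)%N.

Lemma act2_linked (tau : {rmorphism F -> F}) M (f : subsp F n -> subsp F n) :
  M \in unitmx -> (forall U, f U = spn (prp idfun 1%:M (slin tau M (val U)))) ->
  forall A C, linked A C -> linked (f C) (f A).
Proof.
move=> Mu fE A C [rA rC hAC].
have u1 : (1%:M : 'M[F]_n) \in unitmx by apply: unitmx1.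
have fV U : (val (f U) :=: prp idfun 1%:M (slin tau M (val U)))%MS.
  by rewrite fE; apply: val_spn.
split.
- by rewrite fV rank_prp // rank_slin // rC subKn // ltnW.
- by rewrite fV rank_prp // rank_slin // rA.
move: hAC; case: inc => [hAC|/eqP hAC]; first by rewrite !fV prpS // slinS.
rewrite (cap_eqmx (fV C) (fV A)) capmxC -(cap_prp idfun) rank_prp //.
have -> : \rank (slin tau M (val A) + slin tau M (val C))%MS = n.
  have := mxrank_sum_cap (slin tau M (val A)) (slin tau M (val C)).
  by rewrite rank_slin_cap // hAC !rank_slin // rA rC addn0 => ->; rewrite subnKC // ltnW.
by rewrite subnn.
Qed.

Lemma slin_linked (tau : {rmorphism F -> F}) M (f : subsp F n -> subsp F n) :
  M \in unitmx -> (forall U, f U = spn (slin tau M (val U))) ->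
  forall A C, linked A C -> linked (f A) (f C).
Proof.
move=> Mu fE A C [rA rC hAC].
have fV U : (val (f U) :=: slin tau M (val U))%MS by rewrite fE; apply: val_spn.
split; [by rewrite fV rank_slin | by rewrite fV rank_slin |].
move: hAC; case: inc => hAC; first by rewrite !fV slinS.
by rewrite (cap_eqmx (fV A) (fV C)) rank_slin_cap.
Qed.

Lemma AutL2_linked (g : {perm {set subsp F n}}) : g \in AutL2 F n ->
  exists f, (forall Z, g Z = f @: Z) /\
    forall A C, linked A C -> linked (f A) (f C) \/ linked (f C) (f A).
Proof.
rewrite inE => /existsP[s /existsP[M /existsP[b /and3P[/fieldautP[tau tauE] Mu /forallP gM]]]].
exists (act2 s M b); split=> [Z|A C hAC]; first exact/eqP.
case: b {gM}; [right | left].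
  apply: (act2_linked (tau := tau) Mu) hAC => U.
  by rewrite /act2 /prp mul1mx map_mx_id // spn_mksub -tauE.
by apply: (slin_linked (tau := tau) Mu) hAC => U; rewrite /act2 spn_mksub -tauE.
Qed.

Variables (G : {group {perm {set subsp F n}}}) (U W : subsp F n).
Hypotheses (GA : G \subset AutL2 F n) (GN : PSLsoc F n \subset G).
Hypotheses (UW : U != W) (UWl : linked U W) (n8 : (8 <= n)%N).
Local Notation X := (orbit 'P G [set U; W]).

Lemma orbit_linked Z : Z \in X -> exists A C, [/\ Z = [set A; C], A != C & linked A C].
Proof.
case/orbit_permP=> g gG ->; have [f [gf fl]] := AutL2_linked (subsetP GA _ gG).
have fUW : f U != f W.
  apply/eqP => e; case/eqP: UW; apply: set1_inj; apply: (@perm_inj _ g).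
  by rewrite !gf !imset_set1 e.
rewrite gf imsetU1 imset_set1; case: (fl _ _ UWl) => l.
  by exists (f U), (f W).
by exists (f W), (f U); rewrite setUC eq_sym.
Qed.

Lemma orbit_card2 Z : Z \in X -> #|Z| = 2.
Proof. by case/orbit_linked=> A [C [-> hAC _]]; rewrite cards2 hAC. Qed.

Lemma orbit_pair A C : A != C -> [set A; C] \in X -> linked A C \/ linked C A.
Proof.
move=> hAC /orbit_linked[A' [C' [e _ l]]].
by case: (pair_eq_cases hAC e) => -[<- <-]; [left | right].
Qed.

Lemma mem_orbit_psl M : lift_psl M -> [set pm M U; pm M W] \in X.
Proof.
case=> Mu MN; apply/orbit_permP; exists (set_perm (pm M)); first exact: (subsetP GN).
by rewrite set_permE imsetU1 imset_set1.
Qed.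

Hypothesis t0 : (0 < t)%N.

Lemma sub_pm M A x : M \in unitmx -> (x <= val A)%MS -> (x *m M <= val (pm M A))%MS.
Proof. by move=> Mu xA; rewrite pmE // (val_spn _) submxMr. Qed.

Lemma sub_pmE M A x : M \in unitmx -> (x <= val (pm M A))%MS ->
  exists2 y, (y <= val A)%MS & x = y *m M.
Proof.
move=> Mu; rewrite pmE // (val_spn _) => /submxP[D ->].
by exists (D *m val A); rewrite ?submxMl ?mulmxA.
Qed.

Lemma rank_pm M A : M \in unitmx -> \rank (val (pm M A)) = \rank (val A).
Proof. by move=> Mu; rewrite pmE // (val_spn _) mxrankMfree ?row_free_unit. Qed.

Lemma pm_tv_fix A c x : val A *m c = 0 -> x *m c = 0 -> pm (tv c x) A = A.
Proof.
move=> Ac xc; rewrite pmE ?tv_unit // /tv mulmxDr mulmx1 mulmxA Ac mul0mx addr0.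
exact: spnK.
Qed.

Lemma nonzero_ex A : (0 < \rank (val A))%N -> exists2 x : 'rV[F]_n, (x <= val A)%MS & x != 0.
Proof.
move=> rA; have [|x xA x0] := @rank_gt_ex _ _ _ _ (val A) (0 : 'rV[F]_n).
  by rewrite mxrank0.
by exists x => //; apply: contraNneq x0 => ->; rewrite sub0mx.
Qed.

(** The transvection [tv c x] fixes [U] and moves [W], which gives the edge of two pairs sharing
    [U]; [M] provides the pair at distance more than 2. *)
Lemma diam_gt2_pair M c x : lift_psl M -> x *m c = 0 -> val U *m c = 0 ->
  pm (tv c x) W != W ->
  (forall A C, A \in [set U; W] -> C \in [set U; W] -> A != pm M C) ->
  (forall A C, A \in [set U; W] -> C \in [set U; W] ->
     ~ linked A (pm M C) /\ ~ linked (pm M C) A) ->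
  ~ orb_diam_le G X 2.
Proof.
move=> Ml xc Uc WW disj nl.
have n3 : (3 <= n)%N by apply: leq_trans n8.
have X0 : [set U; W] \in X by apply/orbit_permP; exists 1%g; rewrite ?perm1.
have := mem_orbit_psl (lift_psl_tv n3 xc); rewrite (pm_tv_fix Uc xc).
set W' := pm _ W in WW *; move=> X1.
apply: (diam_gt2_share (P1 := [set U; W]) (P3 := [set pm M U; pm M W]) _ _ X0 X1 X0).
- by move=> g gG; have [f [gf _]] := AutL2_linked (subsetP GA _ gG); exists f.
- exact: orbit_card2.
- exact: mem_orbit_psl.
- apply/eqP => e; have : W \in [set U; W'] by rewrite -e set22.
  by rewrite !inE eq_sym (negPf UW) eq_sym (negPf WW).
- by apply/set0Pn; exists U; rewrite !inE eqxx.
- apply/setP => A; rewrite !inE; apply/negbTE/negP => /andP[AU].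
  have AX : A \in [set U; W] by rewrite !inE.
  by case/orP => /eqP e; [have := disj A U AX | have := disj A W AX];
    rewrite -e eqxx !inE eqxx ?orbT => /(_ isT).
- move=> A C AX CX; have [D DX CE] : exists2 D, D \in [set U; W] & C = pm M D.
    by move: CX; rewrite !inE => /orP[]/eqP ->; [exists U | exists W]; rewrite // !inE eqxx ?orbT.
  rewrite CE; apply/negP => /(orbit_pair (disj _ _ AX DX)).
  by have [? ?] := nl _ _ AX DX; case.
Qed.

(** The far pair is the image under [tv c z] with [z] outside [W] and [c] equal to 1 on some [u] in
    [U]. Then [u] is not in the image of [W], and [u + z], in the image of [U], is not in [W], so no
    mixed pair is a flag. *)
Lemma flag_diam_gt2 : inc -> ~ orb_diam_le G X 2.
Proof.
move=> incT; have [rU rW] := UWl; rewrite incT => sUW.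
have tlt : (t < n - t)%N.
  rewrite -rW -rU ltn_neqAle mxrankS // andbT; apply: contra UW => r.
  by apply/eqP; rewrite -(spnK U) -(spnK W); apply/spn_eqP/eqmxP; rewrite -(mxrank_leqif_eq sUW).
have [u uU u0] : exists2 u : 'rV[F]_n, (u <= val U)%MS & u != 0 by apply: nonzero_ex; rewrite rU.
have [|z _ zW] := @rank_gt_ex _ _ _ _ (1%:M : 'M[F]_n) (val W).
  by rewrite mxrank1 rW; clear -t0 tn; lia.
have [|w wW wU] := @rank_gt_ex _ _ _ _ (val W) (val U); first by rewrite rU rW.
have uW : (u <= val W)%MS by apply: submx_trans sUW.
have zscale a : (a *: z <= val W)%MS -> a = 0.
  move=> azW; apply/eqP; apply: contraNT zW => a0.
  by rewrite -[z]scale1r -(mulVf a0) -scalerA scalemx_sub.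
have uz : ~~ (u <= z)%MS.
  apply: contra u0 => /sub_rVP[a uE]; move: uW; rewrite uE => /zscale ->.
  by rewrite scale0r.
have [c zc uc] := covector_ex uz.
have n3 : (3 <= n)%N by apply: leq_trans n8.
have Eu := tv_unit zc.
(* The covector [c'] that defines the edge has to kill [U] and [z] but not [W]. *)
have wS : ~~ (w <= col_mx (val U) z)%MS.
  rewrite -addsmxE; apply: contra wU => /sub_addsmxP[[D1 D2] /= wE].
  have /sub_rVP[a aE] : (D2 *m z <= z)%MS by apply: submxMl.
  have : (a *: z <= val W)%MS.
    have -> : a *: z = w - D1 *m val U by rewrite wE aE addrC addKr.
    by rewrite addmx_sub ?eqmx_opp // mulmx_sub.
  by move/zscale => a0; rewrite wE aE a0 scale0r addr0 submxMl.
have [c' Sc' wc'] := covector_ex wS.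
have [Uc' zc'] : val U *m c' = 0 /\ z *m c' = 0.
  by apply: eq_col_mx; rewrite -mul_col_mx Sc' col_mx0.
have n1 : ~~ (u <= val (pm (tv c z) W))%MS.
  apply/negP => /(sub_pmE Eu)[y yW]; rewrite tvE => uE.
  have : ((y *m c) 0 0 *: z <= val W)%MS.
    have -> : (y *m c) 0 0 *: z = u - y by rewrite uE addrC addKr.
    by rewrite addmx_sub ?eqmx_opp.
  move/zscale => yc; move: uc; rewrite uE yc scale0r addr0 yc => /esym/eqP.
  by rewrite oner_eq0.
have n2 : ~~ (val (pm (tv c z) U) <= val W)%MS.
  apply: contra zW => h; have := submx_trans (sub_pm Eu uU) h.
  rewrite tvE uc scale1r => h'; have -> : z = (u + z) - u by rewrite addrC addKr.
  by rewrite addmx_sub ?eqmx_opp.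
apply: (diam_gt2_pair (lift_psl_tv n3 zc) zc' Uc').
- apply/eqP => e; case/negP: zW; have := sub_pm (tv_unit zc') wW.
  rewrite e tvE wc' scale1r => h; have -> : z = (w + z) - w by rewrite addrC addKr.
  by rewrite addmx_sub ?eqmx_opp.
- move=> A C; rewrite !inE => /orP[]/eqP -> /orP[]/eqP ->; apply/eqP => e.
  + by case/negP: n2; rewrite -e.
  + have := congr1 (fun D : subsp F n => \rank (val D)) e.
    by rewrite /= rank_pm // rU rW; clear -tlt; lia.
  + have := congr1 (fun D : subsp F n => \rank (val D)) e.
    by rewrite /= rank_pm // rU rW; clear -tlt; lia.
  + by case/negP: n1; rewrite -e.
- rewrite /linked incT => A C.
  rewrite !inE => /orP[]/eqP -> /orP[]/eqP ->; rewrite !rank_pm // ?rU ?rW; split=> -[r1 r2 s12];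
    try by clear -tlt r1 r2; lia.
  + by case/negP: n1; apply: submx_trans s12.
  + by case/negP: n2.
Qed.

(** A far pair is one none of whose components is a complement of [U] or [W]. The matrix [R] is the
    usual product of three transvections for the Weyl element of [SL_2] on [u] and [w], and fixes
    the vectors killed by both covectors. *)
Lemma antiflag_diam_gt2 : ~~ inc -> ~ orb_diam_le G X 2.
Proof.
move=> /negbTE incF; have [rU rW] := UWl; rewrite incF mxrank_eq0 => /eqP UW0.
have disj x : (x <= val U)%MS -> (x <= val W)%MS -> x = 0.
  by move=> xU xW; apply/eqP; rewrite -submx0 -UW0 sub_capmx xU.
have n3 : (3 <= n)%N by apply: leq_trans n8.
have [u uU u0] : exists2 u : 'rV[F]_n, (u <= val U)%MS & u != 0 by apply: nonzero_ex; rewrite rU.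
have [w wW w0] : exists2 w : 'rV[F]_n, (w <= val W)%MS & w != 0.
  by apply: nonzero_ex; rewrite rW subn_gt0.
have uW : ~~ (u <= val W)%MS by apply: contra u0 => h; rewrite (disj u).
have wU : ~~ (w <= val U)%MS by apply: contra w0 => h; rewrite (disj w).
have [cu Wcu ucu] := covector_ex uW.
have [cw Ucw wcw] := covector_ex wU.
have subc A c x : val A *m c = 0 -> (x <= val A)%MS -> x *m c = 0.
  by move=> Ac /submxP[D ->]; rewrite -mulmxA Ac mulmx0.
have wcu := subc _ _ _ Wcu wW; have ucw := subc _ _ _ Ucw uU.
have nucw : - u *m cw = 0 by rewrite mulNmx ucw oppr0.
have ca : lift_psl (tv cu w) by apply: lift_psl_tv.
have cb : lift_psl (tv cw (- u)) by apply: lift_psl_tv.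
(* [R] maps [u] to [w] and [w] to [- u], so each of [U], [W] meets the image of the
   other; in equal dimensions it also meets its own image. *)
set R := tv cu w *m tv cw (- u) *m tv cu w.
have Rl : lift_psl R by apply: lift_psl_mul => //; apply: lift_psl_mul.
have Ru : R \in unitmx by case: Rl.
have e00 (a : 'M[F]_1) : a = 0 -> a 0 0 = 0 by move=> ->; rewrite mxE.
have wa : w *m tv cu w = w by rewrite tvE (e00 _ wcu) scale0r addr0.
have wb : w *m tv cw (- u) = w - u by rewrite tvE wcw scale1r.
have ua : u *m tv cu w = u + w by rewrite tvE ucu scale1r.
have ub : u *m tv cw (- u) = u by rewrite tvE (e00 _ ucw) scale0r addr0.
have uR : u *m R = w.
  by rewrite /R !mulmxA ua mulmxDl ub wb addrC subrK wa.
have wR : w *m R = - u.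
  by rewrite /R !mulmxA wa wb mulmxBl wa ua opprD addrCA subrr addr0.
have fixR x : x *m cu = 0 -> x *m cw = 0 -> x *m R = x.
  by move=> xu xw; rewrite /R !mulmxA !tvE !(e00 _ xu, e00 _ xw, scale0r, addr0).
have wUR : (w <= val (pm R U))%MS by rewrite -uR sub_pm.
have uWR : (u <= val (pm R W))%MS by rewrite -[u]opprK -wR eqmx_opp sub_pm.
have fixed_ex A c : (2 <= \rank (val A))%N ->
    exists x : 'rV[F]_n, [/\ (x <= val A)%MS, x != 0 & x *m c = 0].
  move=> r2; have rc := rank_cap_ge (val A) (kermx c).
  have [|x] := @rank_gt_ex _ _ _ _ (val A :&: kermx c)%MS (0 : 'rV[F]_n).
    rewrite mxrank0; move: rc; rewrite mxrank_ker.
    by have := rank_leq_col c; clear -r2 n3; lia.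
  rewrite sub_capmx => /andP[xA /sub_kermxP xc] x0; exists x; split=> //.
  by apply: contraNneq x0 => ->; rewrite sub0mx.
(* If [t = n - t], then [U] and its own image also have complementary dimensions. As [cw] kills [U],
   whose dimension is at least 2, both covectors vanish on some nonzero vector of [U], and [R] fixes
   it; likewise for [W]. *)
have half (r : t = (n - t)%N) :
    (exists x : 'rV[F]_n, [/\ (x <= val U)%MS, x != 0 & (x <= val (pm R U))%MS]) /\
    (exists x : 'rV[F]_n, [/\ (x <= val W)%MS, x != 0 & (x <= val (pm R W))%MS]).
  split.
    have [|x [xU x0 xc]] := fixed_ex U cu; first by rewrite rU; clear -r n8; lia.
    by exists x; split; rewrite // -(fixR x) ?sub_pm // (subc _ _ _ Ucw).
  have [|x [xW x0 xc]] := fixed_ex W cw; first by rewrite rW; clear -r n8; lia.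
  by exists x; split; rewrite // -(fixR x) ?sub_pm // (subc _ _ _ Wcu).
apply: (diam_gt2_pair Rl ucw Ucw).
- apply/eqP => e; case/negP: uW; have := sub_pm (tv_unit ucw) wW.
  rewrite e tvE wcw scale1r => h; have -> : u = (w + u) - w by rewrite addrC addKr.
  by rewrite addmx_sub ?eqmx_opp.
- move=> A C; rewrite !inE => /orP[]/eqP -> /orP[]/eqP ->; apply/eqP => e.
  + by case/negP: wU; rewrite e.
  + have := congr1 (fun D : subsp F n => \rank (val D)) e; rewrite /= rank_pm // rU rW.
    case/half => _ [x [xW x0 xU]]; rewrite -e in xU; case/eqP: x0; exact: disj.
  + have := congr1 (fun D : subsp F n => \rank (val D)) e; rewrite /= rank_pm // rU rW => /esym.
    case/half => [[x [xU x0 xW]] _]; rewrite -e in xW; case/eqP: x0; exact: disj.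
  + by case/negP: uW; rewrite e.
have meet A C x : (x <= val A)%MS -> x != 0 -> (x <= val C)%MS ->
    ~ linked A C /\ ~ linked C A.
  move=> xA x0 xC; rewrite /linked incF; split=> -[_ _]; rewrite mxrank_eq0 => /eqP e;
    case/eqP: x0; apply/eqP; rewrite -submx0 -e sub_capmx ?xA ?xC //.
move=> A C; rewrite !inE => /orP[]/eqP -> /orP[]/eqP ->.
- have [/half[[x [xU x0 xR]] _]|r] := eqVneq t (n - t)%N; first exact: meet xU x0 xR.
  by rewrite /linked rank_pm // rU; split=> -[r1 r2 _]; case/eqP: r; clear -r1 r2; lia.
- exact: meet uU u0 uWR.
- exact: meet wW w0 wUR.
- have [/half[_ [x [xU x0 xR]]]|r] := eqVneq t (n - t)%N; first exact: meet xU x0 xR.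
  by rewrite /linked rank_pm // rW; split=> -[r1 r2 _]; case/eqP: r; clear -r1 r2; lia.
Qed.

End CaseC.

Lemma std_c_diam_gt2 (F : finFieldType) (n : nat) (G : {group {perm {set subsp F n}}})
    (t : nat) (U W : subsp F n) :
  (8 <= n)%N -> std_c G t U W -> ~ orb_diam_le G (orbit 'P G [set U; W]) 2.
Proof.
move=> n8 [GN [_ [GA [_ [_ [_ [/andP[t0 tn] [UW [rU [rW /orP[sUW|UW0]]]]]]]]]]].
  by apply: (flag_diam_gt2 (inc := true) tn GA GN UW _ n8 t0).
apply: (antiflag_diam_gt2 (inc := false) tn GA GN UW _ n8 t0) => //.
by split; rewrite // mxrank_eq0.
Qed.

Theorem theorem1p2 :
  (* forward direction, case (b) with G0 <> PSL and X <> S_t *)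
  (forall (F : finFieldType) (n : nat) (k : ckind) (s : {ffun F -> F})
      (B : 'M[F]_n) (G : {group {perm subsp F n}}) (x0 : subsp F n),
    (8 <= n)%N -> std_b k s B G x0 ->
    orb_diam_eq G (orbit 'P G x0) 2 ->
    let d := \rank (val x0) in
    let kk := minn d (n - d) in
    kk = 1%N \/
    [/\ kk = 2%N, k = Orth, #|F| %% 4 = 3 &
        forall U, U \in orbit 'P G x0 ->
          minus2 B (val U) \/ minus2 B (perpB Orth (idf F) B (val U))])
  /\
  (* forward direction, case (c): diam(X,G) = 2 never holds *)
  (forall (F : finFieldType) (n : nat) (G : {group {perm {set subsp F n}}})
      (t : nat) (U W : subsp F n),
    (8 <= n)%N -> std_c G t U W ->
    ~ orb_diam_eq G (orbit 'P G [set U; W]) 2)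
  /\
  (* converse *)
  (forall (F : finFieldType) (n : nat) (k : ckind) (s : {ffun F -> F})
      (B : 'M[F]_n) (G : {group {perm subsp F n}}) (x0 : subsp F n),
    (8 <= n)%N -> std_b k s B G x0 ->
    minn (\rank (val x0)) (n - \rank (val x0)) = 1%N ->
    orb_diam_eq G (orbit 'P G x0) 2).
Proof.
split=> [F n k s B G x0 n8 stdG [diam _]|]; first by left; exact: (std_b_diam_le2 n8 stdG diam).
split=> [F n G t U W n8 stdG [diam _]|F n k s B G x0].
  exact: (std_c_diam_gt2 n8 stdG diam).
exact: std_b_diam_eq2.
Qed.
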